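(* Let $z$ and $y$ be fixed with $0<z<p$ and $0\le y<Y^{-}(z)$. Then, as $N\to\infty$ through integers for which $n=zN$ is an integer, and with $x=yN$, $$K_n(x)\sim \frac{1}{\sqrt{2\pi N}}\exp\left[N\psi^{-}(y,z)\right]L^{-}(y,z),$$ i.e. the ratio of the two sides tends to $1$.
   Context: Fix real $0<p,q<1$ with $p+q=1$. For integers $n,N\ge 0$ and real $x$, the Krawtchouk polynomial is $$K_n(x)=K_n(x,N,p,q)=\sum_{k=0}^{n}\binom{x}{k}\binom{N-x}{n-k}q^{k}(-p)^{n-k},$$ where $\binom{a}{k}=a(a-1)\cdots(a-k+1)/k!$ for real $a$ and integer $k\geq 0$. For $0<z<1$ put $$U_0(z)=\sqrt{\frac{pq(1-z)}{z}},\qquad Y^{\pm}(z)=p+(q-p)z\pm 2zU_0(z),$$ $$U^{-}(y,z)=-\frac12\left(\frac{p-y}{z}+q-p\right)-\frac12\sqrt{\left(\frac{p-y}{z}+q-p\right)^2-4U_0(z)^2},$$ $$\psi^{-}(y,z)=(z-1)\ln U^{-}+(1-y)\ln(U^{-}-p)+y\ln(U^{-}+q),$$ $$L^{-}(y,z)=\sqrt{\frac{(U^{-}-p)(U^{-}+q)}{z\left[(U^{-})^2-U_0^2\right]}},$$ with $U^{-}=U^{-}(y,z)$. Principal branches are used: for negative $t$, $\ln t=\ln|t|+\pi \mathrm{i}$. *)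

(* Defs.v *)
From mathcomp Require Import all_boot all_order all_algebra.
From mathcomp Require Import all_classical all_reals all_analysis.
From mathcomp Require Import complex.

Set Implicit Arguments.
Unset Strict Implicit.
Unset Printing Implicit Defensive.
Import Order.TTheory GRing.Theory Num.Theory.
Import numFieldNormedType.Exports.
Local Open Scope ring_scope.
Local Open Scope complex_scope.

Definition binomR (R : realType) (a : R) (k : nat) : R :=
  (\prod_(i < k) (a - i%:R)) / k`!%:R.

Definition krawtchouk (R : realType) (p q : R) (N n : nat) (x : R) : R :=
  \sum_(k < n.+1)
    binomR x k * binomR (N%:R - x) (n - k) * q ^+ k * (- p) ^+ (n - k).

(* Principal logarithm of a nonzero real number, as a complex number
   (the value at 0 is junk: [ln 0 = 0]). *)
Definition lnC (R : realType) (t : R) : R[i] :=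
  (ln `|t|) +i* (if t < 0 then pi else 0).

Definition expC (R : realType) (w : R[i]) : R[i] :=
  (expR (complex.Re w))%:C * (cos (complex.Im w) +i* sin (complex.Im w)).

Definition U0 (R : realType) (p q z : R) : R :=
  Num.sqrt (p * q * (1 - z) / z).

Definition Yminus (R : realType) (p q z : R) : R :=
  p + (q - p) * z - 2 * z * U0 p q z.

(* For 0 < z < p and 0 <= y <= Yminus p q z, (p - y) / z + q - p is at least
   2 * U0, so the radicand below is nonnegative, [Num.sqrt] is the principal
   square root and U^- is real. *)
Definition Uminus (R : realType) (p q y z : R) : R :=
  - (1 / 2) * ((p - y) / z + q - p)
  - (1 / 2) * Num.sqrt (((p - y) / z + q - p) ^+ 2 - 4 * U0 p q z ^+ 2).

Definition psiminus (R : realType) (p q y z : R) : R[i] :=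
  let U := Uminus p q y z in
  (z - 1)%:C * lnC U + (1 - y)%:C * lnC (U - p) + y%:C * lnC (U + q).

(* For 0 < z < p and 0 <= y < Yminus p q z one has U < - q, U < - U0 and U < p,
   so the radicand is positive. *)
Definition Lminus (R : realType) (p q y z : R) : R :=
  let U := Uminus p q y z in
  Num.sqrt ((U - p) * (U + q) / (z * (U ^+ 2 - U0 p q z ^+ 2))).

(* Main.v *)
Require Import Defs.
From mathcomp Require Import all_boot all_order all_algebra.
From mathcomp Require Import all_classical all_reals all_analysis.
From mathcomp Require Import complex ring lra.
Import Order.TTheory GRing.Theory Num.Theory.
Import numFieldNormedType.Exports.
Local Open Scope classical_set_scope.
Local Open Scope ring_scope.

(** The proof is a discrete WKB argument on the recurrence in n, with no contour
    integral.

    Write (-1)^n K_n(yN) = C(N, n) s_n. The generating function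
    (1 + q w)^x (1 - p w)^(N - x) gives a three term recurrence for K_n, and the
    division by C(N, n) turns it ([krawtchouk_normalized_rec]) into
      (1 - t) s_(n+1) = B(t) s_n - p q t s_(n-1),   t = n / N,  B(t) = p - y + (q - p) t,
    with s_0 = 1, whose coefficients are regular down to t = 0. With the
    coefficients held constant, X = (1 - t) s_(n+1) / s_n solves X^2 - B(t) X + p q t (1 - t) = 0.
    For y < Y^-(z) and z < p the discriminant decreases on [0, z] and is positive
    at z ([regular_segment]), so the roots are real and distinct on all of
    [0, z]. The larger root P(t) is the dominant one, and -P(z) / z is the saddle
    U^-(y, z).

    The ansatz S_n = exp (N G(t) + g(t)), where G' = ln (P / (1 - t)) and g solves
    the next order equation, has closed form ([is_derive_phase],
    [is_derive_logampl]) with G(0) = g(0) = 0. It satisfies the recurrence up to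
    an error o(1 / N), uniformly in t by compactness ([uniform_defect]). The
    increments of w_n = s_n / S_n obey a first order recurrence whose
    multiplier is the ratio of the two roots, hence is bounded away from 1;
    each increment is therefore o(1 / N), and w_n tends to 1 uniformly for
    n <= z N ([normalized_asymptotics]).

    Stirling's formula for C(N, n), obtained from the Wallis product
    ([cvg_stirling_rem]), supplies the entropy term of psi^- and the factor
    1 / sqrt (2 pi N). All three quantities U^-, U^- - p, U^- + q are negative,
    so the logarithms contribute the total phase pi z N = pi n, which is the
    sign (-1)^n; the moduli give G, g and the entropy ([psiminusE],
    [LminusE]). *)

(** * The recurrence for Krawtchouk polynomials *)

Section Recurrence.
Variable R : realType.

Lemma binomR_rec (a : R) k :
  k.+1%:R * binomR a k.+1 = (a - k%:R) * binomR a k.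
Proof.
rewrite /binomR big_ord_recr /= factS natrM invfM.
have k1 : k.+1%:R != 0 :> R by rewrite pnatr_eq0.
have kf : k`!%:R != 0 :> R by rewrite pnatr_eq0 -lt0n fact_gt0.
by field; rewrite kf addrC natr1 k1.
Qed.

(** If A and B solve first order recurrences, the sums weighted by k and by
    n - k shift into each other; eliminating them leaves only the convolution. *)
Lemma conv_rec (A B : nat -> R) (a b x m : R) :
  (forall k, k.+1%:R * A k.+1 = a * (x - k%:R) * A k) ->
  (forall k, k.+1%:R * B k.+1 = b * (m - k%:R) * B k) ->
  let c n := \sum_(k < n.+1) A k * B (n - k)%N in
  c 1%N = (a * x + b * m) * c 0%N /\
  forall n, n.+2%:R * c n.+2 =
    (a * x + b * m - (a + b) * n.+1%:R) * c n.+1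
    + a * b * (x + m - n%:R) * c n.
Proof.
move=> hA hB c.
pose u n := \sum_(k < n.+1) k%:R * A k * B (n - k)%N.
have uS n : u n.+1 = a * (x * c n - u n).
  rewrite /u big_ord_recl /= !mul0r add0r /c mulr_sumr -sumrB mulr_sumr.
  apply: eq_bigr => k _; rewrite /bump /= add1n subSS hA.
  by ring.
have vS n : n.+1%:R * c n.+1 - u n.+1 = b * (m * c n - (n%:R * c n - u n)).
  rewrite /u /c mulr_sumr -sumrB big_ord_recr /= subnn.
  rewrite mulrA subrr addr0 !mulr_sumr -!sumrB mulr_sumr.
  apply: eq_bigr => k _.
  have kn : (k <= n)%N by rewrite -ltnS.
  have -> : n.+1%:R * (A k * B (n.+1 - k)%N) - k%:R * A k * B (n.+1 - k)%N
    = A k * ((n.+1 - k)%N%:R * B (n.+1 - k)%N) :> R.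
    by rewrite natrB ?(leqW kn) //; ring.
  by rewrite subSn // hB natrB //; ring.
have u0 : u 0%N = 0 by rewrite /u big_ord_recr big_ord0 /= !mul0r addr0.
have uE n : (a - b) * u n = (a * x + b * m - b * n%:R) * c n - n.+1%:R * c n.+1.
  have := vS n; have := uS n => -> h.
  have -> : n.+1%:R * c n.+1 = a * (x * c n - u n) + b * (m * c n - (n%:R * c n - u n)).
    by rewrite -h; ring.
  by ring.
split.
  by have := uE 0%N; rewrite u0; lra.
move=> n.
have h1 := uE n.+1; have h0 := uE n; have hS := uS n.
have e : (a - b) * u n.+1 = a * ((a - b) * x * c n - (a - b) * u n).
  by rewrite hS; ring.
rewrite h1 h0 in e.
have -> : n.+2%:R * c n.+2 = (a * x + b * m - b * n.+1%:R) * c n.+1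
  - a * ((a - b) * x * c n - ((a * x + b * m - b * n%:R) * c n - n.+1%:R * c n.+1)).
  by rewrite -e; ring.
by ring.
Qed.

(** The summand is a product of the coefficients of (1 + q w)^x and
    (1 - p w)^(N - x), each of which has a first order recurrence. *)
Lemma krawtchouk_rec (p q : R) N (x : R) : p + q = 1 ->
  let K n := krawtchouk p q N n x in
  [/\ K 0%N = 1, K 1%N = x - p * N%:R &
  forall n, n.+2%:R * K n.+2 =
    (x - p * N%:R - (q - p) * n.+1%:R) * K n.+1
    - p * q * (N%:R - n%:R) * K n].
Proof.
move=> pq K.
pose A k := binomR x k * q ^+ k.
pose B k := binomR (N%:R - x) k * (- p) ^+ k.
have hA k : k.+1%:R * A k.+1 = q * (x - k%:R) * A k.
  by rewrite /A mulrA binomR_rec exprS; ring.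
have hB k : k.+1%:R * B k.+1 = (- p) * (N%:R - x - k%:R) * B k.
  by rewrite /B mulrA binomR_rec exprS; ring.
have KE n : K n = \sum_(k < n.+1) A k * B (n - k)%N.
  by apply: eq_bigr => k _; rewrite /A /B; ring.
have [c1 c2] := conv_rec _ _ _ _ _ _ hA hB.
have b0 (a : R) : binomR a 0 = 1 by rewrite /binomR big_ord0 mul1r invr1.
have K0 : K 0%N = 1.
  by rewrite KE big_ord_recr big_ord0 /= /A /B !b0 !expr0; ring.
have qE : q = 1 - p by rewrite -pq; ring.
split => //.
  by rewrite KE c1 -KE K0 qE; ring.
by move=> n; rewrite KE c2 -!KE qE; ring.
Qed.

(** The point of dividing by the binomial coefficient: the recurrence now depends
    on n and N only through n / N and has no singularity at n = 0. There the
    last term vanishes, so the value of [n.-1] at 0 is harmless. *)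
Lemma krawtchouk_normalized_rec (p q y : R) (N : nat) : p + q = 1 ->
  let s n := (-1) ^+ n * krawtchouk p q N n (y * N%:R) / 'C(N, n)%:R in
  s 0%N = 1 /\
  forall n t, (n < N)%N -> t = n%:R / N%:R ->
    (1 - t) * s n.+1 = (p - y + (q - p) * t) * s n - p * q * t * s n.-1.
Proof.
move=> pq s; have [K0 K1 K2] := krawtchouk_rec _ _ N (y * N%:R) pq.
split; first by rewrite /s K0 bin0 !mul1r invr1.
have bS n : (n < N)%N -> (n.+1)%:R * 'C(N, n.+1)%:R = (N%:R - n%:R) * 'C(N, n)%:R :> R.
  by move=> nN; rewrite -natrB ?(ltnW nN) // -!natrM mul_bin_left.
have b0 n : (n <= N)%N -> 'C(N, n)%:R != 0 :> R.
  by move=> nN; rewrite pnatr_eq0 -lt0n bin_gt0.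
case=> [|n] t nN ->.
  have N0 : N%:R != 0 :> R by rewrite pnatr_eq0 -lt0n.
  rewrite /s /= K0 K1 bin0 bin1; field.
  by rewrite N0.
have N0 : N%:R != 0 :> R by rewrite pnatr_eq0 -lt0n (leq_ltn_trans _ nN).
have NnE k : (k < N)%N -> N%:R - k%:R != 0 :> R.
  by move=> kN; rewrite subr_eq0 eqr_nat gtn_eqF.
have kS k : k.+1%:R != 0 :> R by rewrite pnatr_eq0.
have e1 : 'C(N, n.+1)%:R = (N%:R - n%:R) * 'C(N, n)%:R / n.+1%:R :> R.
  by rewrite -bS ?(ltnW nN) //; field; rewrite addrC natr1.
have e2 : 'C(N, n.+2)%:R = (N%:R - n.+1%:R) * 'C(N, n.+1)%:R / n.+2%:R :> R.
  by rewrite -bS //; field; rewrite ?addrA ?natr1 ?(addrC 1) ?natr1.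
have e3 : krawtchouk p q N n.+2 (y * N%:R) =
  ((y * N%:R - p * N%:R - (q - p) * n.+1%:R) * krawtchouk p q N n.+1 (y * N%:R)
    - p * q * (N%:R - n%:R) * krawtchouk p q N n (y * N%:R)) / n.+2%:R.
  by rewrite -K2; field; rewrite ?addrA ?natr1 ?(addrC 1) ?natr1.
rewrite /s /= e3 e2 e1 !exprS.
have h1 := NnE _ nN; have h2 := NnE _ (ltnW nN); have h3 := kS n; have h4 := kS n.+1.
have h5 := b0 n (ltnW (ltnW nN)).
move: h1 h2 h3 h4 h5 N0.
move: (krawtchouk p q N n.+1 _) (krawtchouk p q N n _) ('C(N, n)%:R : R) ((-1)^+n).
rewrite -(natr1 n.+1) -(natr1 n); move: (n%:R) (N%:R) => {bS b0 NnE kS e1 e2 e3 K0 K1 K2 s nN} nn NN k1 k0 C sg h1 h2 h3 h4 h5 N0.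
field.
by rewrite N0 h5 h2 h1 h3 h4.
Qed.

End Recurrence.

(** * Uniform Taylor expansions and stability of a contracting recurrence *)

Section RealAnalysis.
Variable R : realType.

(** The upper bound comes from expR (- v) >= 1 - v, that is expR v <= 1 / (1 - v). *)
Lemma expR_taylor1 (v : R) : `|v| <= 2^-1 -> `|expR v - 1 - v| <= 2 * v ^+ 2.
Proof.
rewrite ler_norml => /andP[v1 v2].
have lo := expR_ge1Dx v.
have hi : expR v * (1 - v) <= 1.
  rewrite -[leRHS]expR0 -[in leRHS](subrr v) expRD ler_wpM2l ?expR_ge0 //.
  exact: expR_ge1Dx.
rewrite ger0_norm; last by lra.
have : expR v * (1 - v) <= (1 + v + 2 * v ^+ 2) * (1 - v).
  by apply: (le_trans hi); rewrite -subr_ge0; have : 0 <= v ^+ 2 * (1 - 2 * v);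
    [apply: mulr_ge0; [exact: sqr_ge0|lra] | by congr (0 <= _); ring].
rewrite ler_pM2r; last by lra.
by lra.
Qed.

Lemma mean_value_ball (f f' : R -> R) (t0 d s t : R) :
  (forall x, `|x - t0| < d -> is_derive x 1 f (f' x)) ->
  `|s - t0| < d -> `|t - t0| < d ->
  exists c, [/\ `|c - t0| < d, `|c - t| <= `|s - t|
              & f s - f t = f' c * (s - t)].
Proof.
move=> hf hs ht.
have seg a b : a <= b -> `|a - t0| < d -> `|b - t0| < d ->
    exists2 c, a <= c <= b & f b - f a = f' c * (b - a) /\ `|c - t0| < d.
  move=> ab; rewrite !ltr_norml => /andP[a1 a2] /andP[b1 b2].
  have inb x : a <= x <= b -> `|x - t0| < d.
    by case/andP=> x1 x2; rewrite ltr_norml; apply/andP; split; lra.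
  have [||c] := @MVT_segment R f f' a b ab.
  - by move=> x; rewrite in_itv /= => /andP[/ltW x1 /ltW x2]; apply/hf/inb/andP.
  - apply: derivable_within_continuous => x; rewrite in_itv /= => xab.
    by have [] := hf x (inb x xab).
  by rewrite in_itv /= => cab ->; exists c => //; split => //; exact: inb.
have [st|/ltW ts] := leP t s.
  have [c /andP[c1 c2] [e cd]] := seg _ _ st ht hs.
  by exists c; split => //; rewrite !ger0_norm ?subr_ge0 //; lra.
have [c /andP[c1 c2] [e cd]] := seg _ _ ts hs ht.
exists c; split => //; first by rewrite !ler0_norm ?subr_le0 //; lra.
by rewrite -opprB e; ring.
Qed.

(** By the mean value theorem, because f' is almost constant near t0. Both points
    move, which is what makes the compactness argument below possible. *)
Lemma strict_derivative (f f' : R -> R) (t0 : R) :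
  (\forall x \near t0, is_derive (x : R) 1 f (f' x)) -> {for t0, continuous f'} ->
  forall e, 0 < e -> exists2 d, 0 < d & forall s t,
    `|s - t0| < d -> `|t - t0| < d ->
    `|f s - f t - f' t0 * (s - t)| <= e * `|s - t|.
Proof.
move=> df cf e e0.
have /cvgrPdist_lt /(_ e e0) cf' := cf.
have [d /= d0 hd] : \forall x \near t0, is_derive (x : R) 1 f (f' x) /\ `|f' t0 - f' x| < e.
  by apply: filterS2 df cf' => x; split.
exists d => // s t hs ht.
have hball x : `|x - t0| < d -> is_derive x 1 f (f' x) /\ `|f' t0 - f' x| < e.
  by move=> hx; apply: hd; rewrite /= distrC.
have [c [c1 _ ->]] := mean_value_ball f f' t0 d s t (fun x hx => (hball x hx).1) hs ht.
rewrite -mulrBl normrM ler_wpM2r // distrC ltW //.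
exact: (hball c c1).2.
Qed.

(** The mean value theorem for the difference, as a function of s; its derivative
    is the first order remainder of f, small by strict differentiability. *)
Lemma strict_taylor2 (G f f' : R -> R) (t0 : R) :
  (\forall x \near t0, is_derive (x : R) 1 G (f x)) ->
  (\forall x \near t0, is_derive (x : R) 1 f (f' x)) -> {for t0, continuous f'} ->
  forall e, 0 < e -> exists2 d, 0 < d & forall s t,
    `|s - t0| < d -> `|t - t0| < d ->
    `|G s - G t - f t * (s - t) - f' t0 / 2 * (s - t) ^+ 2| <= e * `|s - t| ^+ 2.
Proof.
move=> [d1 /= d10 dG] df cf e e0.
have [d2 d20 hd2] := strict_derivative _ _ _ df cf _ e0.
exists (Num.min d1 d2); first by rewrite lt_min d10 d20.
move=> s t hs ht.
pose phi x := G x - f t * (x - t) - f' t0 / 2 * (x - t) ^+ 2.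
have dphi x : `|x - t0| < Num.min d1 d2 ->
    is_derive x 1 phi (f x - f t - f' t0 * (x - t)).
  rewrite lt_min => /andP[x1 _].
  have dGx : is_derive x 1 G (f x) by apply: dG; rewrite /= distrC.
  have dx : is_derive x 1 (fun x : R => x - t) 1.
    by apply: is_derive_eq; rewrite subr0.
  have d2x : is_derive x 1 (fun x : R => (x - t) ^+ 2) (2 * (x - t)).
    apply: (is_derive_eq (is_deriveX 2 dx)).
    by rewrite /GRing.scale /= expr1 mulr1.
  have d3 := is_deriveB (is_deriveB dGx (is_deriveZ (f t) dx)) (is_deriveZ (f' t0 / 2) d2x).
  apply: (is_derive_eq d3).
  by rewrite /GRing.scale /=; field.
have [c [c1 c2 e1]] := mean_value_ball _ _ _ _ _ _ dphi hs ht.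
have -> : G s - G t - f t * (s - t) - f' t0 / 2 * (s - t) ^+ 2 = phi s - phi t.
  by rewrite /phi; ring.
rewrite e1 normrM expr2 mulrA ler_wpM2r //.
apply: (le_trans (hd2 c t _ _)).
- by move: c1; rewrite lt_min => /andP[].
- by move: ht; rewrite lt_min => /andP[].
by rewrite ler_wpM2l // ltW.
Qed.

(** With S = exp (G / h + gam) and k = h or k = - h, the exponential below is the
    quotient S (t + k) / S t divided by its leading part exp (lam t * k / h).
    The curvature of G contributes with |k| and the amplitude with k, so that
    forward and backward steps differ in the sign of gam' only. *)
Lemma wkb_step (G lam lam' gam gam' : R -> R) (t0 : R) :
  (\forall x \near t0, is_derive (x : R) 1 G (lam x)) ->
  (\forall x \near t0, is_derive (x : R) 1 lam (lam' x)) -> {for t0, continuous lam'} ->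
  (\forall x \near t0, is_derive (x : R) 1 gam (gam' x)) -> {for t0, continuous gam'} ->
  forall e, 0 < e -> exists2 d, 0 < d & forall t k,
    `|t - t0| < d -> `|k| < d -> k != 0 ->
    `|expR ((G (t + k) - G t - lam t * k) / `|k| + (gam (t + k) - gam t)) - 1
      - (lam' t0 / 2 * `|k| + gam' t0 * k)| <= e * `|k|.
Proof.
move=> dG dlam clam dgam cgam e e0.
have e3 : 0 < e / 3 by rewrite divr_gt0.
have [d1 d10 h1] := strict_taylor2 _ _ _ _ dG dlam clam _ e3.
have [d2 d20 h2] := strict_derivative _ _ _ dgam cgam _ e3.
pose C := `|lam' t0| / 2 + `|gam' t0| + e.
have C0 : 0 < C.
  by have := normr_ge0 (lam' t0); have := normr_ge0 (gam' t0); rewrite /C; lra.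
pose d := Num.min (Num.min (d1 / 2) (d2 / 2)) (Num.min (C^-1 / 2) (e / 3 / (2 * C ^+ 2))).
have d0 : 0 < d.
  by rewrite !lt_min !divr_gt0 ?invr_gt0 // mulr_gt0 // exprn_gt0.
exists d => // t k.
rewrite !lt_min => /andP[/andP[t1 t2] _] /andP[/andP[k1 k2] /andP[k3 k4]] kn0.
have tk m : `|t - t0| < m / 2 -> `|k| < m / 2 -> `|t + k - t0| < m /\ `|t - t0| < m.
  move=> a b; split; last by have := normr_ge0 (t - t0); lra.
  have -> : t + k - t0 = (t - t0) + k by ring.
  by apply: (le_lt_trans (ler_normD _ _)); lra.
have [a1 b1] := tk _ t1 k1; have [a2 b2] := tk _ t2 k2.
have := h1 _ _ a1 b1; have := h2 _ _ a2 b2.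
have -> : t + k - t = k by ring.
have k0 : 0 < `|k| by rewrite normr_gt0.
set X := gam (t + k) - gam t; set Y := G (t + k) - G t - lam t * k.
move=> hX hY.
set v := Y / `|k| + X; set L := lam' t0 / 2 * `|k| + gam' t0 * k.
have vL : `|v - L| <= 2 * (e / 3) * `|k|.
  have -> : v - L = (Y - lam' t0 / 2 * k ^+ 2) / `|k| + (X - gam' t0 * k).
    have kk : k ^+ 2 = `|k| ^+ 2 by rewrite real_normK // num_real.
    by rewrite /v /L kk; field; rewrite gt_eqF.
  apply: (le_trans (ler_normD _ _)).
  have -> : 2 * (e / 3) * `|k| = e / 3 * `|k| + e / 3 * `|k| by ring.
  apply: lerD => //.
  rewrite normrM normfV normr_id ler_pdivrMr //.
  have -> : e / 3 * `|k| * `|k| = e / 3 * `|k| ^+ 2 by ring.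
  exact: hY.
have Lk : `|L| <= (`|lam' t0| / 2 + `|gam' t0|) * `|k|.
  apply: (le_trans (ler_normD _ _)); rewrite mulrDl !normrM normr_id.
  by rewrite [`|2^-1|]ger0_norm // invr_ge0.
have vC : `|v| <= C * `|k|.
  have -> : v = (v - L) + L by ring.
  apply: (le_trans (ler_normD _ _)).
  by have := mulr_ge0 (ltW e0) (ltW k0); rewrite /C; nra.
have v2 : `|v| <= 2^-1.
  apply: (le_trans vC); rewrite mulrC -ler_pdivlMr // mulrC; exact: ltW.
have hv := expR_taylor1 _ v2.
have vv : 2 * v ^+ 2 <= e / 3 * `|k|.
  have -> : v ^+ 2 = `|v| ^+ 2 by rewrite real_normK // num_real.
  apply: (@le_trans _ _ (2 * (C * `|k|) ^+ 2)).
    by rewrite ler_pM2l // lerXn2r ?nnegrE // mulr_ge0 // ltW.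
  have -> : 2 * (C * `|k|) ^+ 2 = (`|k| * (2 * C ^+ 2)) * `|k| by ring.
  rewrite ler_wpM2r // -ler_pdivlMr ?ltW // mulr_gt0 // exprn_gt0 //.
have -> : expR v - 1 - L = (expR v - 1 - v) + (v - L) by ring.
apply: (le_trans (ler_normD _ _)).
by lra.
Qed.

(** While |w| <= 2, the increments never exceed the fixed point C = 2e / (1 - k) of
    the map c -> k c + 2 e; and |w| <= 2 persists as long as N C <= 1. *)
Lemma discrete_stability (w : nat -> R) (N : nat) (k e : R) :
  w 0%N = 1 -> 0 <= k < 1 -> 0 <= e ->
  (forall n, (n < N)%N ->
     `|w n.+1 - w n| <= k * `|w n - w n.-1| + e * `|w n|) ->
  N%:R * (2 * e / (1 - k)) <= 1 ->
  forall n, (n <= N)%N -> `|w n - 1| <= n%:R * (2 * e / (1 - k)).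
Proof.
move=> w0 /andP[k0 k1] e0 hw; set C := 2 * e / (1 - k) => NC.
have k1' : 0 < 1 - k by lra.
have C0 : 0 <= C by rewrite divr_ge0 ?mulr_ge0 // ltW.
have CE : k * C + 2 * e = C by rewrite /C; field; rewrite gt_eqF.
suff H n : (n < N)%N -> `|w n - 1| <= n%:R * C /\ `|w n.+1 - w n| <= C.
  case=> [|n] nN; first by rewrite w0 subrr normr0 mul0r.
  have [a b] := H n nN.
  have -> : w n.+1 - 1 = (w n.+1 - w n) + (w n - 1) by ring.
  by apply: (le_trans (ler_normD _ _)); rewrite -natr1; lra.
elim: n => [|n IH] nN.
  split; first by rewrite w0 subrr normr0 mul0r.
  apply: (le_trans (hw _ nN)).
  rewrite w0 subrr normr0 mulr0 add0r normr1.
  by have := mulr_ge0 k0 C0; lra.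
have [a b] := IH (ltnW nN).
have c : `|w n.+1 - 1| <= n.+1%:R * C.
  have -> : w n.+1 - 1 = (w n.+1 - w n) + (w n - 1) by ring.
  by apply: (le_trans (ler_normD _ _)); rewrite -natr1; lra.
split => //.
have w2 : `|w n.+1| <= 2.
  have -> : w n.+1 = (w n.+1 - 1) + 1 by ring.
  apply: (le_trans (ler_normD _ _)); rewrite normr1.
  have : n.+1%:R * C <= N%:R * C by rewrite ler_wpM2r // ler_nat ltnW.
  by lra.
apply: (le_trans (hw _ nN)) => /=.
have := ler_wpM2l k0 b; have := ler_wpM2l e0 w2.
by lra.
Qed.

End RealAnalysis.

(** * The characteristic equation, the phase and the amplitude *)

(** [trc] is the sum and p q t (1 - t) the product of the roots of the
    characteristic equation of the normalized recurrence; [disc] is its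
    discriminant and [domroot] its larger root. *)
Definition trc {R : realType} (p q y t : R) := p - y + (q - p) * t.
Definition disc {R : realType} (p q y t : R) :=
  trc p q y t ^+ 2 - 4 * p * q * t * (1 - t).
Definition sdisc {R : realType} (p q y t : R) := Num.sqrt (disc p q y t).
Definition domroot {R : realType} (p q y t : R) :=
  (trc p q y t + sdisc p q y t) / 2.
(** Logarithm of the leading order of s_(n+1) / s_n at t = n / N. *)
Definition logratio {R : realType} (p q y t : R) :=
  ln (domroot p q y t) - ln (1 - t).
(** The primitive of [logratio] that vanishes at 0. It is the real part of psi^-
    minus the entropy - t ln t - (1 - t) ln (1 - t) of the binomial coefficient. *)
Definition phase {R : realType} (p q y t : R) :=
  (t - 1) * logratio p q y t + (1 - y) * ln (domroot p q y t + p * t)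
  + y * ln (domroot p q y t - q * t).
(** Logarithm of L^- sqrt (t (1 - t)), the amplitude without the part of the
    binomial coefficient; it vanishes at 0. *)
Definition logampl {R : realType} (p q y t : R) :=
  (ln (domroot p q y t - (q - y) * t) - ln (sdisc p q y t)) / 2.

Definition ddomroot {R : realType} (p q y t : R) :=
  ((q - p) * domroot p q y t - p * q * (1 - 2 * t)) / sdisc p q y t.
Definition dlogratio {R : realType} (p q y t : R) :=
  ddomroot p q y t / domroot p q y t + (1 - t)^-1.
Definition dlogampl {R : realType} (p q y t : R) :=
  - (dlogratio p q y t * trc p q y t / (2 * sdisc p q y t)).

(** The open condition under which all logarithms and quotients above make
    sense. *)
Definition regular {R : realType} (p q y t : R) :=
  [/\ 0 < disc p q y t, 0 < domroot p q y t,
      0 < domroot p q y t + p * t, 0 < domroot p q y t - q * t &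
      0 < domroot p q y t - (q - y) * t /\ t < 1].

Section Symbol.
Variables (R : realType) (p q y : R).
Hypothesis pq1 : p + q = 1.
Notation B := (trc p q y).
Notation D := (sdisc p q y).
Notation P := (domroot p q y).

Let qE : q = 1 - p. Proof. by rewrite -pq1; ring. Qed.

Lemma is_derive_continuous (f : R -> R) (t a : R) :
  is_derive t 1 f a -> {for t, continuous f}.
Proof. by case=> d _; apply: differentiable_continuous; exact/derivable1_diffP. Qed.

Lemma is_derive_ln_comp (f : R -> R) (t a : R) :
  0 < f t -> is_derive t 1 f a -> is_derive t 1 (fun x => ln (f x)) (a / f t).
Proof.
move=> f0 df; have := is_derive1_comp (is_derive1_ln f0) df.
by move=> h; apply: (is_derive_eq h); rewrite mulrC.
Qed.

Lemma near_pos (f : R -> R) (t : R) :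
  {for t, continuous f} -> 0 < f t -> \forall x \near t, 0 < f x.
Proof. by move=> cf f0; exact: (cvgr_gt _ cf). Qed.

Lemma is_derive_affine (a b t : R) : is_derive t 1 (fun x : R => a + b * x) b.
Proof.
have := is_deriveD (is_derive_cst a t 1) (is_deriveZ b (is_derive_id t 1)).
by move=> h; apply: (is_derive_eq h); rewrite /GRing.scale /= mulr1 add0r.
Qed.

Lemma is_derive_disc (t : R) :
  is_derive t 1 (disc p q y) (2 * (q - p) * B t - 4 * p * q * (1 - 2 * t)).
Proof.
have dB := is_derive_affine (p - y) (q - p) t.
have d1 := is_derive_affine 0 (4 * p * q) t.
have d2 := is_derive_affine 1 (- 1) t.
have dd := is_deriveB (is_deriveX 2 dB) (is_deriveM d1 d2).
have -> : disc p q y = (fun x => p - y + (q - p) * x) ^+ 2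
   - (fun x => 0 + 4 * p * q * x) * (fun x => 1 + -1 * x).
  by apply/funext => x; rewrite /disc /trc !fctE; ring.
apply: (is_derive_eq dd).
by rewrite /GRing.scale /= /trc expr1; ring.
Qed.

Lemma is_derive_sdisc (t : R) : 0 < disc p q y t ->
  is_derive t 1 D (((q - p) * B t - 2 * p * q * (1 - 2 * t)) / D t).
Proof.
move=> d0; have := is_derive1_comp (is_derive1_sqrt d0) (is_derive_disc t).
have D0 : sdisc p q y t != 0 by rewrite gt_eqF // sqrtr_gt0.
move=> h; apply: (is_derive_eq h); rewrite -/(sdisc p q y t).
by field.
Qed.

Lemma is_derive_domroot (t : R) : 0 < disc p q y t ->
  is_derive t 1 P (ddomroot p q y t).
Proof.
move=> d0; have dB := is_derive_affine (p - y) (q - p) t.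
have D0 : sdisc p q y t != 0 by rewrite gt_eqF // sqrtr_gt0.
have := is_deriveZ (2^-1) (is_deriveD dB (is_derive_sdisc t d0)).
have -> : P = 2^-1 \*: ((fun x => p - y + (q - p) * x) + D).
  by apply/funext => x; rewrite /domroot /trc /= mulrC.
move=> h; apply: (is_derive_eq h); rewrite /ddomroot /domroot /GRing.scale /=.
by field.
Qed.

Lemma domroot_eq (t : R) : 0 <= disc p q y t ->
  P t ^+ 2 = B t * P t - p * q * t * (1 - t).
Proof.
move=> d0; have : D t ^+ 2 = disc p q y t by rewrite sqr_sqrtr.
rewrite /disc /domroot => h.
have -> : ((B t + D t) / 2) ^+ 2 = (B t ^+ 2 + 2 * B t * D t + D t ^+ 2) / 4 by field.
by rewrite h; field.
Qed.

Lemma is_derive_logratio (t : R) : regular p q y t ->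
  is_derive t 1 (logratio p q y) (dlogratio p q y t).
Proof.
case=> d0 P0 _ _ [_ t1].
have t1' : 0 < 1 + (- 1) * t by lra.
have := is_deriveB (is_derive_ln_comp _ _ _ P0 (is_derive_domroot t d0))
  (is_derive_ln_comp (fun x => 1 + -1 * x) t _ t1' (is_derive_affine 1 (-1) t)).
have -> : logratio p q y = (fun x => ln (P x)) - (fun x => ln (1 + (- 1) * x)).
  by apply/funext => x; rewrite /logratio !fctE mulN1r.
move=> h; apply: (is_derive_eq h); rewrite /dlogratio mulN1r.
by field; rewrite ?subr_eq0 ?gt_eqF //; lra.
Qed.

(** The terms carrying the derivative of the root cancel (E1), because the root is
    a critical point of the phase as a function of P; the remaining explicit
    terms cancel by E2. Both are multiples of the characteristic equation. *)
Lemma is_derive_phase (t : R) : regular p q y t ->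
  is_derive t 1 (phase p q y) (logratio p q y t).
Proof.
move=> gt; have dl := is_derive_logratio t gt.
case: gt => d0 P0 a0 b0 [_ t1].
have dP := is_derive_domroot t d0.
have da := is_deriveD dP (is_derive_affine 0 p t).
have db := is_deriveD dP (is_derive_affine 0 (- q) t).
have a0' : 0 < (P + (fun x => 0 + p * x)) t by rewrite fctE; lra.
have b0' : 0 < (P + (fun x => 0 + - q * x)) t by rewrite fctE; lra.
have := is_deriveD (is_deriveD (is_deriveM (is_derive_affine (- 1) 1 t) dl)
  (is_deriveZ (1 - y) (is_derive_ln_comp _ _ _ a0' da)))
  (is_deriveZ y (is_derive_ln_comp _ _ _ b0' db)).
set F := (F in is_derive t 1 F _).
have -> : F = phase p q y.
  apply/funext => x; rewrite /F /phase !fctE /GRing.scale /=.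
  by rewrite !add0r mul1r mulNr (addrC (-1)).
move=> h; apply: (is_derive_eq h).
rewrite /GRing.scale /= !fctE !add0r mul1r mulNr /dlogratio.
have rel := domroot_eq t (ltW d0).
set dP0 := ddomroot p q y t; set L := logratio p q y t.
have E1 : (1 - y) / (P t + p * t) + y / (P t - q * t) = (1 - t) / P t.
  apply/eqP; rewrite -subr_eq0; apply/eqP.
  transitivity (t * (P t ^+ 2 - (B t * P t - p * q * t * (1 - t)))
     / (P t * (P t + p * t) * (P t - q * t))).
    by rewrite /trc qE; field; rewrite -?qE !gt_eqF.
  by rewrite rel subrr mulr0 mul0r.
have E2 : (1 - y) * p / (P t + p * t) - y * q / (P t - q * t) = 1.
  apply/eqP; rewrite -subr_eq0; apply/eqP.
  transitivity (- (P t ^+ 2 - (B t * P t - p * q * t * (1 - t)))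
     / ((P t + p * t) * (P t - q * t))).
    by rewrite /trc qE; field; rewrite -?qE !gt_eqF.
  by rewrite rel subrr oppr0 mul0r.
transitivity (L + dP0 * ((1 - y) / (P t + p * t) + y / (P t - q * t) - (1 - t) / P t)
  + ((1 - y) * p / (P t + p * t) - y * q / (P t - q * t) - 1)).
  by field; rewrite !gt_eqF //; lra.
by rewrite E1 E2 !subrr mulr0 !addr0.
Qed.

(** Here [dlogampl] is the value that cancels the first order term of the defect of
    the ansatz. Eliminating y through the characteristic equation turns the
    claim into an identity between rational functions of P, t and p. *)
Lemma is_derive_logampl (t : R) : regular p q y t ->
  is_derive t 1 (logampl p q y) (dlogampl p q y t).
Proof.
case=> d0 P0 a0 b0 [g0 t1].
have D0 : 0 < D t by rewrite sqrtr_gt0.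
have dP := is_derive_domroot t d0.
have dg := is_deriveD dP (is_derive_affine 0 (- (q - y)) t).
have g0' : 0 < (P + (fun x => 0 + - (q - y) * x)) t by rewrite fctE; lra.
have := is_deriveZ (2^-1) (is_deriveB (is_derive_ln_comp _ _ _ g0' dg)
  (is_derive_ln_comp _ _ _ D0 (is_derive_sdisc t d0))).
set F := (F in is_derive t 1 F _).
have -> : F = logampl p q y.
  apply/funext => x; rewrite /F /logampl !fctE /GRing.scale /=.
  by rewrite !add0r mulNr [LHS]mulrC.
move=> h; apply: (is_derive_eq h).
rewrite /GRing.scale /= !fctE !add0r mulNr /dlogampl /dlogratio /ddomroot.
have rel := domroot_eq t (ltW d0).
have DE : D t = 2 * P t - B t by rewrite /domroot; field.
have yE : y = p + (q - p) * t - P t - p * q * t * (1 - t) / P t.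
  have : p * q * t * (1 - t) = B t * P t - P t ^+ 2 by rewrite rel; ring.
  by move=> ->; rewrite /trc; field; rewrite gt_eqF.
have BE : B t = P t + p * q * t * (1 - t) / P t by rewrite /trc {1}yE; ring.
have DE2 : D t = P t - p * q * t * (1 - t) / P t by rewrite DE BE; ring.
move: D0 g0; rewrite DE2 BE {DE DE2 BE rel F g0' dg dP d0 a0 b0}.
have t1' : 1 - t != 0 by rewrite gt_eqF // subr_gt0.
move: (P t) P0 yE => r r0 ->; rewrite qE => D0 g0.
have r0' : r != 0 by rewrite gt_eqF.
have D0' : r * r - p * (1 - p) * t * (1 - t) != 0.
  have -> : r * r - p * (1 - p) * t * (1 - t) = (r - p * (1 - p) * t * (1 - t) / r) * r.
    by field.
  by rewrite mulf_neq0 // gt_eqF.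
have g0' : r * r - ((1 - p) * r -
    ((p + (1 - p - p) * t - r) * r - p * (1 - p) * t * (1 - t))) * t != 0.
  set X := (X in X != 0).
  have -> : X = (r - (1 - p - (p + (1 - p - p) * t - r
                        - p * (1 - p) * t * (1 - t) / r)) * t) * r.
    by rewrite /X; field.
  by rewrite mulf_neq0 // gt_eqF.
field.
by rewrite r0' D0' t1' g0'.
Qed.

End Symbol.

(** * Uniform smallness of the defect *)

Section Uniform.
Variables (R : realType) (p q y : R).
Hypothesis pq1 : p + q = 1.
Notation B := (trc p q y).
Notation D := (sdisc p q y).
Notation P := (domroot p q y).
Notation G := (phase p q y).
Notation lam := (logratio p q y).
Notation gam := (logampl p q y).

Lemma continuous_trc (t : R) : {for t, continuous B}.
Proof. exact: is_derive_continuous (is_derive_affine _ _ _ _). Qed.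

Lemma near_regular (t0 : R) : regular p q y t0 -> \forall t \near t0, regular p q y t.
Proof.
case=> d0 P0 a0 b0 [g0 t1].
have cP := is_derive_continuous _ _ _ _ (is_derive_domroot _ p q y t0 d0).
have cA b : {for t0, continuous (fun x => P x + b * x)}.
  by apply: cvgD; [exact: cP|apply: cvgM; [exact: cvg_cst|exact: cvg_id]].
have n1 := near_pos _ _ _ (is_derive_continuous _ _ _ _ (is_derive_disc _ p q y t0)) d0.
have n2 := near_pos _ _ _ cP P0.
have n3 := near_pos _ _ _ (cA p) a0.
have n4 : \forall t \near t0, 0 < P t + - q * t.
  by apply: (near_pos _ _ _ (cA (- q))); rewrite mulNr.
have n5 : \forall t \near t0, 0 < P t + - (q - y) * t.
  by apply: (near_pos _ _ _ (cA (- (q - y)))); rewrite mulNr.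
have n6 : \forall t \near t0, t < 1 by exact: lt_nbhsl.
near=> t; split.
- by near: t.
- by near: t.
- by near: t.
- by rewrite -mulNr; near: t.
- by split; [rewrite -mulNr|]; near: t.
Unshelve. all: by end_near. Qed.

Lemma continuous_dlogratio (t0 : R) : regular p q y t0 ->
  {for t0, continuous (dlogratio p q y)}.
Proof.
case=> d0 P0 a0 b0 [g0 t1].
have cP := is_derive_continuous _ _ _ _ (is_derive_domroot _ p q y t0 d0).
have cD := is_derive_continuous _ _ _ _ (is_derive_sdisc _ p q y t0 d0).
have D0 : D t0 != 0 by rewrite gt_eqF // sqrtr_gt0.
have P0' : P t0 != 0 by rewrite gt_eqF.
have t1' : 1 - t0 != 0 by rewrite subr_eq0 gt_eqF.
have c1 b : (fun x : R => 1 - b * x) @ t0 --> 1 - b * t0.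
  by apply: cvgB; [exact: cvg_cst|apply: cvgM; [exact: cvg_cst|exact: cvg_id]].
apply: cvgD.
  apply: cvgM; last exact: (cvgV P0' cP).
  apply: cvgM; last exact: (cvgV D0 cD).
  apply: cvgB; apply: cvgM => //; exact: cvg_cst.
apply: cvgV => //.
by apply: cvgB; [exact: cvg_cst|exact: cvg_id].
Qed.

Lemma continuous_dlogampl (t0 : R) : regular p q y t0 ->
  {for t0, continuous (dlogampl p q y)}.
Proof.
move=> r0; have cl := continuous_dlogratio t0 r0.
case: r0 => d0 P0 a0 b0 [g0 t1].
have cD := is_derive_continuous _ _ _ _ (is_derive_sdisc _ p q y t0 d0).
have D0 : 2 * D t0 != 0 by rewrite mulf_neq0 // gt_eqF // sqrtr_gt0.
apply: cvgN; apply: cvgM.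
  by apply: cvgM; [exact: cl|exact: continuous_trc].
by apply: cvgV => //; apply: cvgM => //; exact: cvg_cst.
Qed.

(** The quotient S (t + k) / S t of the ansatz, divided by its leading part
    exp (+- lambda t), where k = +h or -h. *)
Definition quot_corr (t k : R) : R :=
  expR ((G (t + k) - G t - lam t * k) / `|k| + (gam (t + k) - gam t)).

(** Put l = lam' t0, g = gam' t0. The two corrections are 1 + h (l / 2 + g) and
    1 + h (l / 2 - g) up to o(h), so the defect is h (B l / 2 + D g) + o(h), and
    g is chosen such that B l / 2 + D g = 0 at t0. The expansions hold for all t
    near t0; compactness of [0, z] makes them uniform. *)
Lemma uniform_defect (z : R) : (forall t, 0 <= t <= z -> regular p q y t) ->
  forall e, 0 < e -> \forall h \near 0^'+, forall t, 0 <= t <= z ->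
  [/\ `|quot_corr t h - 1| <= e, `|quot_corr t (- h) - 1| <= e &
   `|P t * quot_corr t h - B t + (B t - P t) * quot_corr t (- h)| <= e * h].
Proof.
move=> reg e e0.
pose Q h t := [/\ `|quot_corr t h - 1| <= e, `|quot_corr t (- h) - 1| <= e &
   `|P t * quot_corr t h - B t + (B t - P t) * quot_corr t (- h)| <= e * h].
have /compact_near_coveringP/(_ R (0^'+) Q) := @segment_compact R 0 z.
have F0 : Filter (0:R)^'+ by typeclasses eauto.
move=> /(_ F0) cover.
suff H : \forall h \near 0^'+, `[0, z]%classic `<=` Q h.
  by apply: filterS H => h hQ t tz; apply: hQ; rewrite /= in_itv.
apply: cover => t0; rewrite /= in_itv /= => tz.
have r0 := reg _ tz.
have rn := near_regular _ r0.
set l := dlogratio p q y t0; set g := dlogampl p q y t0.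
have D0 : 0 < D t0 by case: r0 => d0 _ _ _ _; rewrite sqrtr_gt0.
pose K := `|P t0| + 1 + (`|B t0 - P t0| + 1).
have K0 : 0 < K by rewrite /K; have := normr_ge0 (P t0); have := normr_ge0 (B t0 - P t0); lra.
have e1 : 0 < e / (2 * K) by rewrite divr_gt0 // mulr_gt0.
have dG : \forall x \near t0, is_derive (x : R) 1 G (lam x).
  by apply: filterS rn => x; exact: is_derive_phase.
have dL : \forall x \near t0, is_derive (x : R) 1 lam (dlogratio p q y x).
  by apply: filterS rn => x; exact: is_derive_logratio.
have dA : \forall x \near t0, is_derive (x : R) 1 gam (dlogampl p q y x).
  by apply: filterS rn => x; exact: is_derive_logampl.
have [d d0 step] := wkb_step _ _ _ _ _ _ _ dG dL (continuous_dlogratio _ r0)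
  dA (continuous_dlogampl _ r0) _ e1.
have cP : {for t0, continuous P}.
  by case: r0 => h _ _ _ _; exact: is_derive_continuous (is_derive_domroot _ _ _ _ _ h).
have cD : {for t0, continuous D}.
  by case: r0 => h _ _ _ _; exact: is_derive_continuous (is_derive_sdisc _ _ _ _ _ h).
have cB := continuous_trc t0.
pose c t := B t * (l / 2) + D t * g.
have c0 : c t0 = 0.
  by rewrite /c /g /dlogampl -/l; field; rewrite gt_eqF.
have n1 : \forall t \near t0, `|c t| < e / 2.
  have cc : c @ t0 --> c t0.
    by apply: cvgD; apply: cvgM => //; exact: cvg_cst.
  have /cvgrPdist_lt /(_ (e / 2)) := cc.
  rewrite c0 divr_gt0 // => /(_ isT); apply: filterS => t.
  by rewrite sub0r normrN.
have n2 : \forall t \near t0, `|P t| < `|P t0| + 1.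
  have /cvgrPdist_lt /(_ 1 ltr01) := cP; apply: filterS => t h.
  have -> : P t = P t0 - (P t0 - P t) by ring.
  by apply: (le_lt_trans (ler_normB _ _)); rewrite ltrD2l.
have n3 : \forall t \near t0, `|B t - P t| < `|B t0 - P t0| + 1.
  have cBP : (fun t => B t - P t) @ t0 --> B t0 - P t0 by exact: cvgB.
  have /cvgrPdist_lt /(_ 1 ltr01) := cBP; apply: filterS => t h.
  have -> : B t - P t = B t0 - P t0 - (B t0 - P t0 - (B t - P t)) by ring.
  by apply: (le_lt_trans (ler_normB _ _)); rewrite ltrD2l.
have n4 : \forall t \near t0, `|t - t0| < d.
  by exists d => // t /=; rewrite distrC.
pose C := `|l| / 2 + `|g| + e / (2 * K).
have C0 : 0 < C by rewrite /C; have := normr_ge0 l; have := normr_ge0 g; lra.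
have m1 : \forall h \near (0:R)^'+, 0 < h by exact: nbhs_right_gt.
have m2 : \forall h \near (0:R)^'+, h < d by exact: nbhs_right_lt.
have m3 : \forall h \near (0:R)^'+, h < e / C by apply: nbhs_right_lt; rewrite divr_gt0.
exists ([set t | [/\ `|c t| < e / 2, `|P t| < `|P t0| + 1,
     `|B t - P t| < `|B t0 - P t0| + 1 & `|t - t0| < d]],
   [set h | [/\ 0 < h, h < d & h < e / C]]); rewrite /=.
  split; last by apply: filterS3 m1 m2 m3 => h; split.
  by apply: filterS2 (filterI n1 n2) (filterI n3 n4) => t [? ?] [? ?]; split.
move=> [t h] /= [[t1 t2 t3 t4] [h0 hd hC]].
have hn : `|h| = h by rewrite gtr0_norm.
have s1 : `|quot_corr t h - 1 - (l / 2 * h + g * h)| <= e / (2 * K) * h.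
  by have := step t h t4; rewrite -/(quot_corr t h) hn; apply; rewrite ?gt_eqF.
have s2 : `|quot_corr t (- h) - 1 - (l / 2 * h + g * - h)| <= e / (2 * K) * h.
  by have := step t (- h) t4; rewrite -/(quot_corr t (- h)) normrN hn; apply; rewrite ?oppr_eq0 ?gt_eqF.
have hC' : C * h <= e by rewrite mulrC -ler_pdivlMr // ltW.
have small E a : `|a| <= `|g| -> `|E - 1 - (l / 2 * h + a * h)| <= e / (2 * K) * h -> `|E - 1| <= e.
  move=> ag hE.
  have -> : E - 1 = (E - 1 - (l / 2 * h + a * h)) + (l / 2 + a) * h by ring.
  apply: (le_trans (ler_normD _ _)); apply: le_trans hC'.
  have -> : C * h = e / (2 * K) * h + (`|l| / 2 + `|g|) * h by rewrite /C; ring.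
  apply: lerD => //.
  rewrite normrM hn; apply: ler_wpM2r; first exact: ltW.
  apply: (le_trans (ler_normD _ _)); rewrite lerD //.
  by rewrite normrM [`|2^-1|]ger0_norm // invr_ge0.
split; first exact: (small _ g).
  by apply: (small _ (- g)); [rewrite normrN|rewrite mulNr -mulrN].
move: (quot_corr t h) (quot_corr t (- h)) s1 s2 => E1 E2 s1 s2.
have DE : D t = P t - (B t - P t) by rewrite /domroot; field.
have -> : P t * E1 - B t + (B t - P t) * E2 =
   P t * (E1 - 1 - (l / 2 * h + g * h))
   + (B t - P t) * (E2 - 1 - (l / 2 * h + g * - h)) + c t * h.
  by rewrite /c DE; field.
apply: (le_trans (ler_normD _ _)).
have u1 : `|c t * h| <= e / 2 * h by rewrite normrM hn ler_wpM2r // ltW.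
have u2 : `|P t * (E1 - 1 - (l / 2 * h + g * h))
   + (B t - P t) * (E2 - 1 - (l / 2 * h + g * - h))| <= e / 2 * h.
  apply: (le_trans (ler_normD _ _)); rewrite (normrM (P t)) (normrM (B t - P t)).
  have -> : e / 2 * h = (`|P t0| + 1) * (e / (2 * K) * h)
     + (`|B t0 - P t0| + 1) * (e / (2 * K) * h).
    by rewrite -mulrDl -/K; field; rewrite gt_eqF.
  by apply: lerD; apply: ler_pM => //; exact: ltW.
lra.
Qed.

(** The discriminant decreases on [0, z], so it stays above its value at z, and
    P - q t = (D + (p - y - t)) / 2 stays positive. *)
Lemma regular_segment (z : R) : 0 < p -> 0 < q -> 0 <= y -> z < p - y ->
  0 < disc p q y z -> forall t, 0 <= t <= z ->
  [/\ regular p q y t, D z <= D t, B t <= 1 & D t <= B t].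
Proof.
move=> p0 q0 y0 zpy dz t /andP[t0 tz].
have qE : q = 1 - p by rewrite -pq1; ring.
have dzt : disc p q y z <= disc p q y t.
  (* each term of the second factor is nonnegative since t <= z < p - y *)
  rewrite -subr_ge0.
  have -> : disc p q y t - disc p q y z =
     (z - t) * ((2 * (p - y - z) + (z - t)) + 4 * q * y).
    by rewrite /disc /trc qE; ring.
  rewrite mulr_ge0 //; first lra.
  by have := mulr_ge0 (ltW q0) y0; nra.
have Dzt : D z <= D t by rewrite /sdisc ler_wsqrtr.
have Dz0 : 0 < D z by rewrite /sdisc sqrtr_gt0.
have Dt2 : D t ^+ 2 = disc p q y t by rewrite sqr_sqrtr //; lra.
have qt : 0 <= q * t by exact: mulr_ge0 (ltW q0) t0.
have pt : 0 <= p * t by exact: mulr_ge0 (ltW p0) t0.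
have yt : 0 <= y * t by exact: mulr_ge0.
have Bqt : B t = 2 * (q * t) + (p - y - t) by rewrite /trc qE; ring.
have B1 : B t <= 1 by rewrite /trc; nra.
have DB : D t <= B t.
  have B0 : 0 <= B t by lra.
  rewrite -[leRHS]ger0_norm // -[leRHS]sqrtr_sqr; apply: ler_wsqrtr.
  rewrite /disc gerBl mulr_ge0 //; last lra.
  by rewrite -!mulrA pmulr_rge0 // pmulr_rge0.
split => //; rewrite /regular /domroot.
split; try split; lra.
Qed.

End Uniform.

(** * Convergence of the normalized values to the ansatz *)

Definition signed_quot {R : realType} (p q y : R) (N n : nat) : R :=
  (-1) ^+ n * krawtchouk p q N n (y * N%:R) / 'C(N, n)%:R.

Definition ansatz {R : realType} (p q y : R) (N n : nat) : R :=
  expR (N%:R * phase p q y (n%:R / N%:R) + logampl p q y (n%:R / N%:R)).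

(** The two roots of the characteristic equation are P and B - P; their ratio is
    at most 1 - delta when delta bounds the root of the discriminant below. *)
Lemma contraction_step {R : realType} (delta b d r E1 E2 e df eta x x0 w : R) :
  0 < delta -> delta <= d -> d <= b -> b <= 1 -> r = (b + d) / 2 ->
  e <= delta / 8 -> `|E1 - 1| <= e -> `|E2 - 1| <= e -> `|df| <= eta ->
  r * E1 * x = (b - r) * E2 * x0 - df * w ->
  `|x| <= (1 - delta / 2) * `|x0| + 2 * eta / delta * `|w|.
Proof.
move=> D0 Dd db b1 rE eD h1 h2 h3 inc.
rewrite ler_norml in h1; rewrite ler_norml in h2; rewrite ler_norml in h3.
case/andP: h1 => E1l _; case/andP: h2 => E2l E2u; case/andP: h3 => df1 df2.
have eta0 : 0 <= eta by lra.
have E1b : 1 - delta / 8 <= E1 by lra.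
have E20 : 0 <= E2 by lra.
have E2b : E2 <= 1 + delta / 8 by lra.
have a1 : delta * b <= delta by rewrite ler_piMr // ltW.
have a2 : delta * d <= d by rewrite ler_piMl //; lra.
have a3 : delta * delta <= delta by rewrite ler_piMr //; lra.
set M := b - r in inc.
have M0 : 0 <= M by rewrite /M; lra.
have PD : delta <= r by lra.
have MP : M <= (1 - delta) * r by rewrite /M rE; lra.
have r0 : 0 < r by lra.
have E10 : 0 < E1 by lra.
have X0 : 0 < r * E1 by exact: mulr_gt0.
have X1 : delta / 2 <= r * E1.
  have E0 : 0 <= 1 - delta / 8 by lra.
  by have := ler_pM (ltW D0) E0 PD E1b; lra.
have X2 : M * E2 <= (1 - delta / 2) * (r * E1).
  apply: (@le_trans _ _ (((1 - delta) * r) * (1 + delta / 8))); first exact: ler_pM.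
  apply: (@le_trans _ _ ((1 - delta / 2) * (r * (1 - delta / 8)))); last first.
    by rewrite ler_wpM2l ?ler_wpM2l //; lra.
  rewrite -subr_ge0.
  have -> : (1 - delta / 2) * (r * (1 - delta / 8)) - (1 - delta) * r * (1 + delta / 8)
     = r * delta * (1/4 + 3 / 16 * delta) by field.
  by rewrite mulr_ge0 ?mulr_ge0 //; lra.
rewrite -(ler_pM2l X0).
have -> : r * E1 * `|x| = `|r * E1 * x| by rewrite normrM (gtr0_norm X0).
rewrite inc.
apply: (le_trans (ler_normB _ _)); rewrite mulrDr; apply: lerD.
  rewrite normrM ger0_norm ?mulr_ge0 // mulrA ler_wpM2r //.
  by rewrite [leRHS]mulrC.
rewrite normrM mulrA ler_wpM2r //.
apply: (@le_trans _ _ eta); first by rewrite ler_norml; apply/andP; split; lra.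
apply: (@le_trans _ _ (delta / 2 * (2 * eta / delta))).
  by rewrite le_eqVlt; apply/orP; left; apply/eqP; field; rewrite gt_eqF.
by rewrite ler_wpM2r // divr_ge0 ?mulr_ge0 // ltW.
Qed.

Section Normalized.
Variables (R : realType) (p q y z : R).
Hypotheses (p0 : 0 < p) (q0 : 0 < q) (pq1 : p + q = 1) (y0 : 0 <= y).
Hypotheses (z0 : 0 < z) (zpy : z < p - y) (dz : 0 < disc p q y z).
Notation B := (trc p q y).
Notation D := (sdisc p q y).
Notation P := (domroot p q y).
Notation G := (phase p q y).
Notation lam := (logratio p q y).
Notation gam := (logampl p q y).

Lemma ansatz0 N : ansatz p q y N 0 = 1.
Proof.
have py : 0 < p - y by exact: lt_trans z0 zpy.
have D0 : D 0 = p - y.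
  rewrite /sdisc /disc /trc !mulr0 mul0r subr0 addr0 sqrtr_sqr ger0_norm //; exact: ltW.
have P0 : P 0 = p - y by rewrite /domroot D0 /trc mulr0 addr0; field.
rewrite /ansatz mul0r /phase /logampl /logratio P0 D0 !mulr0 !subr0 addr0 ln1.
by rewrite -[RHS]expR0; congr expR; ring.
Qed.

Lemma expR_logratio (t : R) : t < 1 -> 0 < P t -> expR (lam t) = P t / (1 - t).
Proof. by move=> t1 P0; rewrite /logratio expRB !lnK // posrE subr_gt0. Qed.

Lemma quot_corr_fwd (N n : nat) (t := n%:R / N%:R) : (0 < N)%N -> t < 1 -> 0 < P t ->
  P t * quot_corr _ p q y t N%:R^-1 =
  (1 - t) * (ansatz p q y N n.+1 / ansatz p q y N n).
Proof.
move=> N0 t1 P0; have N0' : 0 < N%:R :> R by rewrite ltr0n.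
have t1' : 1 - t != 0 by rewrite gt_eqF // subr_gt0.
have E : t + N%:R^-1 = n.+1%:R / N%:R by rewrite -natr1 mulrDl mul1r.
rewrite /ansatz -expRB -E -/t /quot_corr ger0_norm ?invr_ge0 ?ler0n //.
transitivity (P t * expR ((N%:R * G (t + N%:R^-1) + gam (t + N%:R^-1)
   - (N%:R * G t + gam t)) - lam t)).
  by congr (_ * expR _); field; rewrite gt_eqF.
rewrite (expRB _ (lam t)) expR_logratio //.
by field; rewrite t1' gt_eqF.
Qed.

Lemma quot_corr_bwd (N n : nat) (t := n.+1%:R / N%:R) : (0 < N)%N -> t < 1 -> 0 < P t ->
  quot_corr _ p q y t (- N%:R^-1) / P t =
  ansatz p q y N n / ansatz p q y N n.+1 / (1 - t).
Proof.
move=> N0 t1 P0; have N0' : 0 < N%:R :> R by rewrite ltr0n.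
have t1' : 1 - t != 0 by rewrite gt_eqF // subr_gt0.
have E : t + - N%:R^-1 = n%:R / N%:R by rewrite /t -natr1 mulrDl mul1r addrK.
rewrite /ansatz -expRB -E -/t /quot_corr normrN ger0_norm ?invr_ge0 ?ler0n //.
transitivity (expR ((N%:R * G (t + - N%:R^-1) + gam (t + - N%:R^-1)
   - (N%:R * G t + gam t)) + lam t) / P t).
  by congr (expR _ / _); field; rewrite gt_eqF.
rewrite (expRD _ (lam t)) expR_logratio //.
by field; rewrite t1' gt_eqF.
Qed.

(** The quotient w of the normalized Krawtchouk numbers by the ansatz satisfies
    a recurrence whose coefficients add up to the defect, so that its
    increments obey a contraction. *)
Lemma quotient_increment (N n : nat) (t := n%:R / N%:R) (h := N%:R^-1)
   (w := fun n => signed_quot p q y N n / ansatz p q y N n) :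
  (n < N)%N -> regular p q y t ->
  P t * quot_corr _ p q y t h * (w n.+1 - w n) =
  (B t - P t) * quot_corr _ p q y t (- h) * (w n - w n.-1)
  - (P t * quot_corr _ p q y t h - B t
     + (B t - P t) * quot_corr _ p q y t (- h)) * w n.
Proof.
move=> nN [d0 P0 _ _ [_ t1]].
have N0 : (0 < N)%N by exact: leq_ltn_trans nN.
have S0 k : ansatz p q y N k != 0 by rewrite gt_eqF // expR_gt0.
have [_ /(_ n t nN erefl) rec] := krawtchouk_normalized_rec R p q y N pq1.
rewrite -/(signed_quot p q y N n.+1) -/(signed_quot p q y N n) -/(signed_quot p q y N n.-1) in rec.
have rel := domroot_eq R p q y t (ltW d0).
have BP : B t - P t = p * q * t * (1 - t) / P t.
  have -> : p * q * t * (1 - t) = B t * P t - P t ^+ 2 by rewrite rel; ring.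
  by field; rewrite gt_eqF.
have t1' : 1 - t != 0 by rewrite gt_eqF // subr_gt0.
have main : P t * quot_corr _ p q y t h * w n.+1 =
   B t * w n - (B t - P t) * quot_corr _ p q y t (- h) * w n.-1.
  rewrite quot_corr_fwd // -/t.
  transitivity (((1 - t) * signed_quot p q y N n.+1) / ansatz p q y N n).
    rewrite /w; move: (S0 n) (S0 n.+1).
    move: (ansatz p q y N n) (ansatz p q y N n.+1) (signed_quot p q y N n.+1) => a b c a0 b0.
    by field; rewrite a0 b0.
  rewrite rec mulrBl -/(trc p q y t); congr (_ - _); first by rewrite /w mulrA.
  rewrite BP.
  case: n @t @w nN d0 P0 t1 rec rel BP t1' => [|m] t w nN d0 P0 t1 rec rel BP t1'.
    by rewrite /t !(mul0r, mulr0).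
  have := quot_corr_bwd N m N0 t1 P0; rewrite -/t -/h => bw.
  transitivity (p * q * t * (1 - t) * (quot_corr _ p q y t (- h) / P t) * w m); last by rewrite /=; ring.
  rewrite bw /w /= -/t; move: (S0 m) (S0 m.+1).
  move: (ansatz p q y N m) (ansatz p q y N m.+1) (signed_quot p q y N m) => a b c a0 b0.
  by move: (t) t1' => u u1; field; rewrite u1 a0 b0.
rewrite mulrBr main.
move: (w n) (w n.-1) (quot_corr _ p q y t h) (quot_corr _ p q y t (- h)) (B t) (P t).
by move=> w1 w0 E1 E2 b r; ring.
Qed.

(** The defect e1 / N per step, divided by a leading coefficient of at least
    D z / 2 and amplified by at most 2 / D z through the contraction, adds up
    to O(e1) over at most N steps. *)
Lemma normalized_asymptotics (e : R) : 0 < e -> \forall N \near \oo,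
  forall n, n%:R <= z * N%:R -> `|signed_quot p q y N n / ansatz p q y N n - 1| <= e.
Proof.
move=> e0.
have seg := regular_segment R p q y pq1 z p0 q0 y0 zpy dz.
have D0 : 0 < D z by rewrite sqrtr_gt0.
have D1 : D z <= 1.
  have [|_ _ b1 db] := seg z; first by rewrite lexx ltW.
  exact: le_trans db b1.
have DD : 0 < D z ^+ 2 / 8 by rewrite divr_gt0 // exprn_gt0.
(* D z / 8 is what the contraction needs; the other bound keeps the sum of the N
   increments below the minimum of 1 and e *)
pose e1 := Num.min (D z / 8) (Num.min 1 e * (D z ^+ 2 / 8)).
have e10 : 0 < e1 by rewrite lt_min divr_gt0 //= mulr_gt0 // lt_min ltr01.
have e1D : e1 <= D z / 8 by rewrite ge_min lexx.
have e1e : 8 * e1 / D z ^+ 2 <= Num.min 1 e.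
  have -> : 8 * e1 / D z ^+ 2 = e1 / (D z ^+ 2 / 8) by field; rewrite gt_eqF.
  by rewrite ler_pdivrMr // ge_min lexx orbT.
clearbody e1.
have [d /= dp unif] := uniform_defect R p q y pq1 z (fun t tz => let: And4 r _ _ _ := seg t tz in r) e1 e10.
near=> N.
have Nd : d^-1 < N%:R by near: N; exact: nbhs_infty_gtr.
have N0' : 0 < N%:R :> R by apply: lt_trans Nd; rewrite invr_gt0.
have N0 : (0 < N)%N by rewrite -(ltr0n R).
have hd : N%:R^-1 < d by rewrite -[d]invrK ltf_pV2 // posrE invr_gt0.
have h0 : 0 < N%:R^-1 :> R by rewrite invr_gt0.
have {unif} unif : forall t, 0 <= t <= z ->
    let E1 := quot_corr _ p q y t N%:R^-1 in let E2 := quot_corr _ p q y t (- N%:R^-1) in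
    [/\ `|E1 - 1| <= e1, `|E2 - 1| <= e1 &
        `|P t * E1 - B t + (B t - P t) * E2| <= e1 * N%:R^-1].
  by apply: unif => //=; rewrite sub0r normrN gtr0_norm.
move=> n nz.
have tz (k : nat) : (k <= n)%N -> 0 <= (k%:R / N%:R : R) <= z.
  move=> kn; rewrite divr_ge0 //= ler_pdivrMr //.
  by apply: le_trans nz; rewrite ler_nat.
have z1 : z < 1 by move: q0 pq1 y0 zpy; lra.
have nN : (n < N)%N.
  rewrite -(ltr_nat R); apply: le_lt_trans nz _.
  by rewrite gtr_pMl.
pose w k := signed_quot p q y N k / ansatz p q y N k.
have NC : N%:R * (2 * (2 * e1 / (D z * N%:R)) / (1 - (1 - D z / 2))) <= Num.min 1 e.
  apply: le_trans e1e; rewrite le_eqVlt; apply/orP; left; apply/eqP.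
  by field; rewrite !gt_eqF.
apply: (@le_trans _ _ (n%:R * (2 * (2 * e1 / (D z * N%:R)) / (1 - (1 - D z / 2))))); last first.
  apply: (@le_trans _ _ (Num.min 1 e)); last by rewrite ge_min lexx orbT.
  apply: le_trans NC; rewrite ler_wpM2r ?ler_nat 1?ltnW //.
  have e2 : 0 < 2 * e1 / (D z * N%:R) by rewrite divr_gt0 ?mulr_gt0.
  by rewrite divr_ge0 //; lra.
apply: (discrete_stability R w n (1 - D z / 2)) => //.
- have [s0 _] := krawtchouk_normalized_rec R p q y N pq1.
  by rewrite /w ansatz0 // invr1 mulr1.
- by apply/andP; split; lra.
- by rewrite divr_ge0 ?mulr_ge0 // ltW.
- move=> k kn.
  have tk := tz k (ltnW kn).
  have kN : (k < N)%N by exact: ltn_trans nN.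
  have [rg Dk B1 DB] := seg _ tk.
  have [E1b E2b db] := unif _ tk.
  have inc := quotient_increment N k kN rg.
  have := contraction_step _ _ _ _ _ _ _ _ _ _ _ _ D0 Dk DB B1 erefl e1D E1b E2b db inc.
  have -> : 2 * (e1 * N%:R^-1) / D z = 2 * e1 / (D z * N%:R).
    by rewrite invfM; ring.
  exact.
apply: (@le_trans _ _ (Num.min 1 e)); last by rewrite ge_min lexx.
apply: le_trans NC; rewrite ler_wpM2r ?ler_nat 1?ltnW //.
have e2 : 0 < 2 * e1 / (D z * N%:R) by rewrite divr_gt0 ?mulr_gt0.
by rewrite divr_ge0 //; lra.
Unshelve. all: by end_near. Qed.

End Normalized.

(** * Stirling's formula *)

Section Stirling.
Variable R : realType.

Lemma nondecreasing_segment (f f' : R -> R) (a b : R) : a <= b ->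
  (forall x, a <= x <= b -> is_derive x 1 f (f' x)) ->
  (forall x, a <= x <= b -> 0 <= f' x) -> f a <= f b.
Proof.
move=> ab df f0.
have [||c] := @MVT_segment R f f' a b ab.
- by move=> x; rewrite in_itv /= => /andP[/ltW x1 /ltW x2]; apply/df/andP.
- apply: derivable_within_continuous => x; rewrite in_itv /= => xab.
  by have [] := df x xab.
rewrite in_itv /= => cab e.
by rewrite -subr_ge0 e mulr_ge0 ?subr_ge0 ?f0.
Qed.

Lemma is_derive_ln1D (x : R) : 0 <= x -> is_derive x 1 (fun t : R => ln (1 + t)) (1 + x)^-1.
Proof.
move=> x0.
have d1 : is_derive x 1 (fun t : R => 1 + t) 1.
  have := is_derive_affine R 1 1 x.
  by under eq_fun do rewrite mul1r.
have := is_derive_ln_comp _ (fun t => 1 + t) x _ (_ : 0 < 1 + x) d1.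
by rewrite div1r; apply; lra.
Qed.

Lemma is_derive_inv_affine (a x : R) : 0 < a + x -> is_derive x 1 (fun t : R => (a + t)^-1) (- (a + x) ^- 2).
Proof.
move=> ax.
have d1 : is_derive x 1 (fun t : R => a + t) 1.
  have := is_derive_affine R a 1 x.
  by under eq_fun do rewrite mul1r.
have := is_deriveV _ d1; rewrite gt_eqF // => /(_ isT) h.
by apply: (is_derive_eq h); rewrite /GRing.scale /= mulr1.
Qed.

(** Together with [ln1D_le], brackets (n + 1/2) ln (1 + 1/n) between 1 and
    1 + 1 / (4 n (n + 1)). *)
Lemma ln1D_ge (x : R) : 0 <= x -> 2 * x / (2 + x) <= ln (1 + x).
Proof.
move=> x0.
have := nondecreasing_segment (fun t => ln (1 + t) + 4 * (2 + t)^-1)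
  (fun t => (1 + t)^-1 + 4 * (- (2 + t) ^- 2)) 0 x x0.
rewrite !addr0 ln1 add0r => h.
suff : 4 / 2 <= ln (1 + x) + 4 / (2 + x).
  have -> : 2 * x / (2 + x) = 2 - 4 / (2 + x) by field; lra.
  by lra.
apply: h => t /andP[t0 _].
  have t2 : 0 < 2 + t by lra.
  have := is_deriveD (is_derive_ln1D _ t0) (is_deriveZ 4 (is_derive_inv_affine _ _ t2)).
  exact.
have -> : (1 + t)^-1 + 4 * - (2 + t) ^- 2 = t ^+ 2 / ((1 + t) * (2 + t) ^+ 2).
  by field; apply/andP; split; rewrite gt_eqF //; lra.
by rewrite divr_ge0 ?sqr_ge0 // mulr_ge0 ?sqr_ge0 //; lra.
Qed.

Lemma ln1D_le (x : R) : 0 <= x -> ln (1 + x) <= (x + x / (1 + x)) / 2.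
Proof.
move=> x0.
have := nondecreasing_segment (fun t => (1 + t) + (- 1) * (1 + t)^-1 + (- 2) * ln (1 + t))
  (fun t => 1 + (- 1) * (- (1 + t) ^- 2) + (- 2) * (1 + t)^-1) 0 x x0.
rewrite !addr0 ln1 mulr0 addr0 invr1 mulr1 subrr => h.
suff : 0 <= 1 + x + -1 / (1 + x) + -2 * ln (1 + x).
  have -> : x / (1 + x) = 1 - 1 / (1 + x) by field; lra.
  by rewrite mulN1r div1r; lra.
apply: h => t /andP[t0 _].
  have t2 : 0 < 1 + t by lra.
  have d1 := is_derive_affine R 1 1 t.
  have := is_deriveD (is_deriveD d1 (is_deriveZ (-1) (is_derive_inv_affine _ _ t2)))
    (is_deriveZ (-2) (is_derive_ln1D _ t0)).
  set F := (F in is_derive t 1 F _).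
  by have -> : F = (fun t => 1 + t + -1 / (1 + t) + -2 * ln (1 + t));
    [apply/funext => s; rewrite /F /= !fctE mul1r|].
have -> : 1 + -1 * - (1 + t) ^- 2 + -2 / (1 + t) = (1 - (1 + t)^-1) ^+ 2.
  by field; lra.
exact: sqr_ge0.
Qed.

Definition stirling_rem (n : nat) : R := ln (n`!%:R) - (n%:R + 2^-1) * ln n%:R + n%:R.

(** The remainder decreases, and by a telescoping amount, so it converges; only its
    limit is left to the Wallis product. *)
Lemma stirling_rem_diff n : (0 < n)%N ->
  0 <= stirling_rem n - stirling_rem n.+1 <= (n%:R^-1 - n.+1%:R^-1) / 4.
Proof.
move=> n0; have n0' : 0 < n%:R :> R by rewrite ltr0n.
have x0 : 0 <= n%:R^-1 :> R by rewrite invr_ge0 ltW.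
have S0 : 0 < n%:R + 1 :> R by lra.
have E : ln (1 + n%:R^-1) = ln n.+1%:R - ln n%:R :> R.
  rewrite -ln_div ?posrE ?ltr0n // -natr1; congr ln; field.
  by rewrite gt_eqF.
have -> : stirling_rem n - stirling_rem n.+1 = (n%:R + 2^-1) * ln (1 + n%:R^-1) - 1.
  rewrite E /stirling_rem factS natrM lnM ?posrE ?ltr0n ?fact_gt0 //.
  by rewrite -natr1; ring.
have lo := ln1D_ge _ x0; have hi := ln1D_le _ x0.
have h0 : 0 <= n%:R + 2^-1 :> R by lra.
have := ler_wpM2l h0 lo; have := ler_wpM2l h0 hi.
have -> : (n%:R + 2^-1) * (2 * n%:R^-1 / (2 + n%:R^-1)) = 1 :> R.
  by field; rewrite !gt_eqF //; lra.
have -> : (n%:R + 2^-1) * ((n%:R^-1 + n%:R^-1 / (1 + n%:R^-1)) / 2)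
  = 1 + (n%:R^-1 - n.+1%:R^-1) / 4 :> R.
  by rewrite -natr1; field; rewrite !gt_eqF //; lra.
move: (_ * ln _) ((_ - _) / 4) => a b ab a1.
by apply/andP; split; lra.
Qed.

Lemma is_cvg_stirling_rem : cvgn stirling_rem.
Proof.
suff : cvgn (fun n => stirling_rem n.+1).
  by move=> h; apply/cvg_ex; exists (limn (fun n => stirling_rem n.+1)); rewrite -cvg_shiftS.
apply: nonincreasing_is_cvgn.
  apply/nonincreasing_seqP => n.
  by have /andP[h _] := stirling_rem_diff n.+1 isT; rewrite -subr_ge0.
exists (stirling_rem 1 - 1 / 4) => _ [n _ <-].
suff : stirling_rem 1 - stirling_rem n.+1 <= (1 - n.+1%:R^-1) / 4.
  have : 0 < n.+1%:R^-1 :> R by rewrite invr_gt0 ltr0n.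
  by move: (n.+1%:R^-1) => a a0; lra.
elim: n => [|n IH]; first by rewrite invr1 !subrr mul0r.
have /andP[_] := stirling_rem_diff n.+1 isT.
by move: IH; move: (n.+1%:R^-1) (n.+2%:R^-1) => a b IH h; lra.
Qed.

(** Primitives of the powers of the sine, from the reduction formula; their
    values at pi / 2 are the Wallis numbers. *)
Fixpoint sin_prim (n : nat) (x : R) : R :=
  match n with
  | 0 => x
  | m.+1 => match m with
            | 0 => 1 - cos x
            | k.+1 => (m%:R * sin_prim k x - cos x * sin x ^+ m) / n%:R
            end
  end.

Lemma is_derive_sin_prim n (x : R) : is_derive x 1 (sin_prim n) (sin x ^+ n).
Proof.
suff [] : is_derive x 1 (sin_prim n) (sin x ^+ n) /\
  is_derive x 1 (sin_prim n.+1) (sin x ^+ n.+1) by [].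
elim: n => [|n [IH0 IH1]].
  split; first exact: is_derive_id.
  have := is_deriveB (is_derive_cst (1 : R) x 1) (is_derive_cos x) => h.
  by apply: (is_derive_eq h); rewrite sub0r opprK expr1.
split=> //.
have n2 : n.+2%:R != 0 :> R by rewrite pnatr_eq0.
have := is_deriveZ (n.+2%:R^-1) (is_deriveB (is_deriveZ n.+1%:R IH0)
   (is_deriveM (is_derive_cos x) (is_deriveX n.+1 (is_derive_sin x)))).
set F := (F in is_derive x 1 F _) => h.
have -> : sin_prim n.+2 = F by apply/funext => t; rewrite /F /= !fctE /GRing.scale /= [LHS]mulrC.
apply: (is_derive_eq h); rewrite /GRing.scale /= !fctE !exprS.
have c2 : cos x * cos x = 1 - sin x * sin x.
  by have := cos2Dsin2 x; rewrite !expr2 => <-; ring.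
transitivity (n.+2%:R^-1 *
  (n.+1%:R * sin x ^+ n * (1 - cos x * cos x) + sin x * sin x * sin x ^+ n)).
  by congr (_ * _); ring.
have {}n2 : n.+1%:R + 1 != 0 :> R by rewrite natr1.
by rewrite c2 -(natr1 n.+1); field.
Qed.

Definition wallis n : R := sin_prim n (pi / 2).

Lemma wallisSS n : n.+2%:R * wallis n.+2 = n.+1%:R * wallis n.
Proof.
rewrite /wallis /= cos_pihalf mul0r subr0 mulrCA divff ?mulr1 // pnatr_eq0.
Qed.

Lemma wallis0 : wallis 0 = pi / 2. Proof. by []. Qed.
Lemma wallis1 : wallis 1 = 1. Proof. by rewrite /wallis /= cos_pihalf subr0. Qed.

Lemma wallis_ge0 n : 0 <= wallis n.
Proof.
suff [] : 0 <= wallis n /\ 0 <= wallis n.+1 by [].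
elim: n => [|n [IH0 IH1]].
  by rewrite wallis0 wallis1; split => //; rewrite divr_ge0 ?pi_ge0.
split => //; rewrite -(pmulr_rge0 _ (_ : 0 < n.+2%:R)) ?ltr0n // wallisSS.
by rewrite mulr_ge0.
Qed.

Lemma sin_prim0 n : sin_prim n 0 = 0.
Proof.
suff [] : sin_prim n 0 = 0 /\ sin_prim n.+1 0 = 0 by [].
elim: n => [|n [IH0 IH1]]; first by rewrite /= cos0 subrr.
by split=> //; rewrite /= IH0 sin0 exprS mul0r !mulr0 subrr mul0r.
Qed.

Lemma wallis_noninc n : wallis n.+1 <= wallis n.
Proof.
rewrite -subr_ge0.
have pi0 : 0 <= pi / 2 :> R by rewrite divr_ge0 ?pi_ge0.
have := nondecreasing_segment (sin_prim n - sin_prim n.+1)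
  (fun x => sin x ^+ n - sin x ^+ n.+1) 0 (pi / 2) pi0.
rewrite !fctE !sin_prim0 subrr; apply => x /andP[x0 x1].
  exact: is_deriveB (is_derive_sin_prim _ _) (is_derive_sin_prim _ _).
have s0 : 0 <= sin x.
  by apply: sin_ge0_pi; rewrite x0 /=; have := @pi_ge0 R; lra.
rewrite exprS -{1}[_ ^+ n]mul1r -mulrBl mulr_ge0 ?exprn_ge0 //.
Qed.

Lemma wallis_prod n : n.+1%:R * (wallis n * wallis n.+1) = pi / 2.
Proof.
elim: n => [|n IH]; first by rewrite wallis0 wallis1 mulr1 mul1r.
by rewrite mulrCA wallisSS -IH; ring.
Qed.

Lemma wallis_even m : wallis (2 * m) = pi / 2 * ((2 * m)`!%:R / (4 ^+ m * (m`!%:R) ^+ 2)).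
Proof.
elim: m => [|m IH]; first by rewrite muln0 wallis0 fact0 expr0 expr1n mulr1 divr1 mulr1.
have := wallisSS (2 * m).
have -> : (2 * m).+2 = (2 * m.+1)%N by rewrite mulnS.
have n2 : (2 * m.+1)%:R != 0 :> R by rewrite pnatr_eq0.
move=> h; apply: (mulfI n2); rewrite h IH.
have -> : (2 * m.+1)`! = ((2 * m.+1) * (2 * m).+1 * (2 * m)`!)%N by rewrite mulnS !factS mulnA.
rewrite factS !natrM (exprS (4 : R) m) -(natr1 (2 * m)) -(natr1 m) !natrM.
have m1 : m%:R + 1 != 0 :> R by rewrite natr1 pnatr_eq0.
have f0 : m`!%:R != 0 :> R by rewrite pnatr_eq0 -lt0n fact_gt0.
have p4 : 4 ^+ m != 0 :> R by rewrite expf_neq0.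
by field; rewrite m1 f0 p4.
Qed.

(** Let c be the limit. By the product formula and monotonicity, m W_(2m)^2 tends
    to pi / 4; through the factorials it tends to (pi^2 / 2) exp (- 2 c). *)
Lemma cvg_stirling_rem : stirling_rem n @[n --> \oo] --> ln (2 * pi) / 2.
Proof.
have pi0 := pi_gt0 R.
have cu := is_cvg_stirling_rem.
set c := limn stirling_rem in cu; have {}cu : stirling_rem n @[n --> \oo] --> c by [].
suff <- : c = ln (2 * pi) / 2 by [].
pose v m := m%:R * wallis (2 * m) ^+ 2.
have cv1 : v m @[m --> \oo] --> pi / 4.
  have c1 : (fun m : nat => pi / 4 - pi / 4 * m.+1%:R^-1) @ \oo --> (pi : R) / 4.
    rewrite -[X in _ --> X]subr0 -(mulr0 (pi / 4)).
    apply: cvgB; first exact: cvg_cst.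
    by apply: cvgM; [exact: cvg_cst|exact: cvg_harmonic].
  apply: (squeeze_cvgr _ c1); last exact: cvg_cst.
  near=> m.
  have m0 : (0 < m)%N by near: m; exists 1%N.
  have m0' : 0 < m%:R :> R by rewrite ltr0n.
  have W0 := wallis_ge0 (2 * m).
  have h1 := wallis_prod (2 * m).
  have h2 := wallis_prod (2 * m).-1.
  have m2 : (2 * m).-1.+1 = (2 * m)%N by rewrite prednK // muln_gt0.
  rewrite m2 in h2.
  have g1 := ler_wpM2l W0 (wallis_noninc (2 * m)).
  have g2 := ler_wpM2l W0 (wallis_noninc (2 * m).-1).
  rewrite m2 in g2.
  rewrite -natr1 natrM in h1; rewrite natrM in h2.
  apply/andP; split.
    rewrite /v expr2.
    have m1 : 0 < m%:R + 1 :> R by lra.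
    have := ler_wpM2l (ltW m0') g1.
    apply: le_trans.
    have -> : wallis (2 * m) * wallis (2 * m).+1 = pi / 2 / (2 * m%:R + 1).
      by rewrite -h1; field; lra.
    have -> : m%:R * (pi / 2 / (2 * m%:R + 1)) = pi / 4 - pi / 4 * (2 * m%:R + 1)^-1 :> R.
      by field; lra.
    rewrite lerD2l lerN2 ler_wpM2l //; first by rewrite divr_ge0 // ltW.
    by rewrite lef_pV2 ?posrE -?natr1; lra.
  rewrite /v expr2.
  have := ler_wpM2l (ltW m0') g2.
  move=> /le_trans; apply.
  rewrite le_eqVlt; apply/orP; left; apply/eqP.
  have -> : wallis (2 * m) * wallis (2 * m).-1 = pi / 2 / (2 * m%:R).
    by rewrite -h2; field; rewrite gt_eqF.
  by field; rewrite gt_eqF.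
have cv2 : v m @[m --> \oo] --> pi ^+ 2 / 2 * expR (2 * (c - 2 * c)).
  have c2 : (fun m => stirling_rem (2 * m)) @ \oo --> c.
    apply: (@cvg_comp _ _ _ (fun m => 2 * m)%N stirling_rem \oo \oo (nbhs c)) cu.
    by apply/cvgnyPge => A; exists A => // k /= /leq_trans; apply; rewrite leq_pmull.
  have c3 : (fun m => 2 * (stirling_rem (2 * m) - 2 * stirling_rem m)) @ \oo --> 2 * (c - 2 * c).
    apply: cvgM; first exact: cvg_cst.
    by apply: cvgB => //; apply: cvgM; [exact: cvg_cst|].
  have ce : (fun m : nat => pi ^+ 2 / 2 * expR (2 * (stirling_rem (2 * m) - 2 * stirling_rem m))) @ \oo
      --> pi ^+ 2 / 2 * expR (2 * (c - 2 * c)).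
    apply: cvgM; first exact: cvg_cst.
    exact: (cvg_comp _ _ c3 (@continuous_expR R _)).
  apply: cvg_trans ce; apply: near_eq_cvg; near=> m.
  have m0 : (0 < m)%N by near: m; exists 1%N.
  have m0' : 0 < m%:R :> R by rewrite ltr0n.
  have fE k : (0 < k)%N -> k`!%:R = expR (stirling_rem k + (k%:R + 2^-1) * ln k%:R - k%:R) :> R.
    move=> k0; rewrite -[LHS]lnK ?posrE ?ltr0n ?fact_gt0 //; congr expR.
    by rewrite /stirling_rem; ring.
  rewrite /v wallis_even !fE ?muln_gt0 // natrM lnM ?posrE ?ltr0n //.
  set a := stirling_rem (2 * m); set b := stirling_rem m.
  have -> : 4 ^+ m = expR (m%:R * (2 * ln 2)) :> R.
    by rewrite expRM_natl mulr_natl expRD lnK ?posrE ?ltr0n // -natrM.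
  have -> : expR (a + (2 * m%:R + 2^-1) * (ln 2 + ln m%:R) - 2 * m%:R)
     / (expR (m%:R * (2 * ln 2)) * expR (b + (m%:R + 2^-1) * ln m%:R - m%:R) ^+ 2)
     = expR (a - 2 * b + (ln 2 - ln m%:R) / 2).
    by rewrite -expRM_natl -expRD -expRB; congr expR; field.
  have -> : m%:R * (pi / 2 * expR (a - 2 * b + (ln 2 - ln m%:R) / 2)) ^+ 2
    = m%:R * (pi ^+ 2 / 4 * expR (2 * (a - 2 * b) + (ln 2 - ln m%:R))).
    rewrite exprMn -expRM_natl; congr (_ * (_ * expR _)); by field.
  rewrite expRD expRB !lnK ?posrE ?ltr0n //.
  by field; rewrite gt_eqF.
have E : pi / 4 = pi ^+ 2 / 2 * expR (2 * (c - 2 * c)) by exact: (cvg_unique _ cv1 cv2).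
have E2 : expR (2 * c) = 2 * pi.
  have -> : 2 * c = - (2 * (c - 2 * c)) by ring.
  rewrite expRN; apply: invr_inj; rewrite invrK.
  apply: (mulfI (_ : pi ^+ 2 / 2 != 0)).
    by rewrite mulf_neq0 // ?expf_neq0 // gt_eqF.
  rewrite -E; move: pi0; move: (pi : R) => x x0.
  by field; rewrite gt_eqF.
by rewrite -E2 expRK; field.
Unshelve. all: by end_near. Qed.
End Stirling.

(** * Binomial coefficients, the saddle point and the limit *)

Local Open Scope complex_scope.

Section Binomial.
Variable R : realType.

Lemma binomial_stirling (z : R) (N n : nat) : 0 < z < 1 -> (0 < N)%N ->
  n%:R = z * N%:R ->
  'C(N, n)%:R = expR (stirling_rem R N - stirling_rem R n - stirling_rem R (N - n)
    + N%:R * (- z * ln z - (1 - z) * ln (1 - z)) - (ln z + ln (1 - z) + ln N%:R) / 2).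
Proof.
move=> /andP[z0 z1] N0 nz.
have N0' : 0 < N%:R :> R by rewrite ltr0n.
have z1' : 0 < 1 - z by lra.
have nN : (n <= N)%N by rewrite -(ler_nat R) nz ger_pMl // ltW.
have n0 : (0 < n)%N by rewrite -(ltr0n R) nz mulr_gt0.
have mE : (N - n)%:R = (1 - z) * N%:R by rewrite natrB // nz; ring.
have m0 : (0 < N - n)%N by rewrite -(ltr0n R) mE mulr_gt0.
have fE k : (0 < k)%N -> k`!%:R = expR (stirling_rem R k + (k%:R + 2^-1) * ln k%:R - k%:R) :> R.
  move=> k0; rewrite -[LHS]lnK ?posrE ?ltr0n ?fact_gt0 //; congr expR.
  by rewrite /stirling_rem; ring.
have -> : 'C(N, n)%:R = N`!%:R / (n`!%:R * (N - n)`!%:R) :> R.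
  rewrite -(bin_fact nN) !natrM mulfK // mulf_neq0 // pnatr_eq0 -lt0n fact_gt0 //.
rewrite !fE // -expRD -expRB mE nz !lnM ?posrE //.
by congr expR; field.
Qed.
End Binomial.

Section Complex.
Variable R : realType.

Lemma cosn_pi n : cos (n%:R * pi) = (-1) ^+ n :> R.
Proof.
elim: n => [|n IH]; first by rewrite mul0r cos0 expr0.
by rewrite -natr1 mulrDl mul1r cosDpi IH exprS mulN1r.
Qed.

Lemma sinn_pi n : sin (n%:R * pi) = 0 :> R.
Proof.
elim: n => [|n IH]; first by rewrite mul0r sin0.
by rewrite -natr1 mulrDl mul1r sinDpi IH oppr0.
Qed.

Lemma cvg_real_complex (T : Type) (F : set_system T) (FF : Filter F) (u : T -> R) (l : R) :
  u x @[x --> F] --> l -> (u x)%:C @[x --> F] --> (l%:C : R[i]^o).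
Proof.
move=> /cvgrPdist_lt ul; apply/(@cvgrPdist_lt _ R[i]^o) => e; rewrite ltcE /= => /andP[/eqP e2 e1].
apply: filterS (ul _ e1) => x xl.
have -> : (l%:C : R[i]^o) - (u x)%:C = (l - u x)%:C by rewrite -rmorphB.
by rewrite normc_def /= expr0n /= addr0 sqrtr_sqr ltcE /= -e2 eqxx.
Qed.

Lemma sqrt_expR_ln (t : R) : 0 < t -> Num.sqrt t = expR (ln t / 2).
Proof.
move=> t0; transitivity (Num.sqrt (expR (ln t / 2) ^+ 2)).
  by rewrite -expRM_natl mulrC divfK // lnK.
by rewrite sqrtr_sqr gtr0_norm ?expR_gt0.
Qed.

End Complex.

Section Saddle.
Variables (R : realType) (p q y z : R).
Hypotheses (p0 : 0 < p) (q0 : 0 < q) (pq1 : p + q = 1) (y0 : 0 <= y).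
Hypotheses (z0 : 0 < z) (zp : z < p) (yY : y < Yminus p q z).
Notation B := (trc p q y).
Notation D := (sdisc p q y).
Notation P := (domroot p q y).

Lemma z_lt1 : z < 1. Proof. by move: q0 pq1 zp; lra. Qed.

Lemma U0_sqr : (z * U0 p q z) ^+ 2 = p * q * z * (1 - z).
Proof.
have z1 := z_lt1.
rewrite exprMn sqr_sqrtr; last by rewrite divr_ge0 ?mulr_ge0 ?ltW // subr_gt0.
by field; rewrite gt_eqF.
Qed.

Lemma U0_ge : q * z <= z * U0 p q z.
Proof.
have z1 := z_lt1.
have U0p : 0 <= z * U0 p q z by rewrite mulr_ge0 ?sqrtr_ge0 // ltW.
rewrite -ler_sqr ?nnegrE ?mulr_ge0 ?(ltW q0) ?(ltW z0) ?sqrtr_ge0 // U0_sqr.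
rewrite -subr_ge0.
have -> : p * q * z * (1 - z) - (q * z) ^+ 2 = q * z * (p - (p + q) * z) by ring.
by rewrite pq1 mul1r mulr_ge0 ?mulr_ge0 ?ltW // subr_gt0.
Qed.

(** The gap p - z - y exceeds 2 (z U0 - q z), which is nonnegative because z < p. *)
Lemma lt_pBy : z < p - y.
Proof.
have := U0_ge; move: yY; rewrite /Yminus.
have -> : (q - p) * z = 2 * (q * z) - (p + q) * z by ring.
by rewrite pq1 mul1r -mulrA; move: (q * z) (z * _) => a b; lra.
Qed.

(** The bound y < Y^- says exactly that B z > 2 z U0, and (2 z U0)^2 = B^2 - disc. *)
Lemma disc_gt0 : 0 < disc p q y z.
Proof.
have U0p : 0 <= z * U0 p q z by rewrite mulr_ge0 ?sqrtr_ge0 // ltW.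
have h : 2 * (z * U0 p q z) < B z by move: yY; rewrite /Yminus /trc -mulrA; lra.
rewrite /disc subr_gt0.
have -> : 4 * p * q * z * (1 - z) = (2 * (z * U0 p q z)) ^+ 2.
  by rewrite exprMn U0_sqr; ring.
have U2 : 0 <= 2 * (z * U0 p q z) by rewrite mulr_ge0.
by rewrite ltr_sqr ?nnegrE // (le_trans U2) // ltW.
Qed.

Lemma regular_z : regular p q y z.
Proof.
have [|] := regular_segment R p q y pq1 z p0 q0 y0 lt_pBy disc_gt0 z; last by [].
by rewrite lexx ltW.
Qed.

Lemma UminusE : Uminus p q y z = - (P z / z).
Proof.
have z0' : z != 0 by rewrite gt_eqF.
rewrite /Uminus.
have e : (p - y) / z + q - p = B z / z by rewrite /trc; field.
have -> : ((p - y) / z + q - p) ^+ 2 - 4 * U0 p q z ^+ 2 = disc p q y z / z ^+ 2.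
  have -> : U0 p q z ^+ 2 = p * q * z * (1 - z) / z ^+ 2 by rewrite -U0_sqr; field.
  by rewrite e /disc; field.
rewrite sqrtrM ?(ltW disc_gt0) // sqrtrV ?sqr_ge0 // sqrtr_sqr gtr0_norm //.
by rewrite e -/(sdisc p q y z) /domroot; field.
Qed.

(** The three arguments of the logarithms are negative, and their branches add up
    to pi ((z - 1) + (1 - y) + y) = pi z. *)
Lemma psiminusE : psiminus p q y z =
  (phase p q y z + (- z * ln z - (1 - z) * ln (1 - z))) +i* (z * pi).
Proof.
have [_ P0 a0 b0 [_ z1]] := regular_z.
have z0' : z != 0 by rewrite gt_eqF.
have lnCneg (t : R) : 0 < t -> lnC (- (t / z)) = (ln t - ln z) +i* pi.
  move=> t0; have tz : 0 < t / z by rewrite divr_gt0.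
  by rewrite /lnC normrN gtr0_norm // oppr_lt0 tz ln_div ?posrE.
rewrite /psiminus UminusE.
have -> : - (P z / z) - p = - ((P z + p * z) / z) by field.
have -> : - (P z / z) + q = - ((P z - q * z) / z) by field.
rewrite !lnCneg // /phase /logratio.
apply/eqP; rewrite eq_complex /=; apply/andP; split; apply/eqP; ring.
Qed.

(** By the characteristic equation, z (U^2 - U0^2) = P D / z and
    (U - p) (U + q) (1 - z) = P (P - (q - y) z) / z^2. *)
Lemma LminusE : Lminus p q y z =
  expR (logampl p q y z - (ln z + ln (1 - z)) / 2).
Proof.
have [d0 P0 a0 b0 [g0 z1]] := regular_z.
have z0' : z != 0 by rewrite gt_eqF.
have D0 : 0 < D z by rewrite sqrtr_gt0.
have qE : q = 1 - p by rewrite -pq1; ring.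
have z1' : 0 < 1 - z by rewrite subr_gt0.
have rel := domroot_eq R p q y z (ltW d0).
have DE : D z = 2 * P z - B z by rewrite /domroot; field.
rewrite /Lminus UminusE.
have -> : (- (P z / z) - p) * (- (P z / z) + q) / (z * ((- (P z / z)) ^+ 2 - U0 p q z ^+ 2))
   = (P z - (q - y) * z) / D z / (z * (1 - z)).
  have -> : U0 p q z ^+ 2 = p * q * z * (1 - z) / z ^+ 2 by rewrite -U0_sqr; field.
  have pqz : p * q * z * (1 - z) = B z * P z - P z ^+ 2 by rewrite rel; ring.
  have den : (- (P z / z)) ^+ 2 - p * q * z * (1 - z) / z ^+ 2 = P z * D z / z ^+ 2.
    by rewrite pqz DE; field.
  rewrite den.
  have num : (- (P z / z) - p) * (- (P z / z) + q) * (1 - z) = P z * (P z - (q - y) * z) / z ^+ 2.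
    apply/eqP; rewrite -subr_eq0; apply/eqP.
    transitivity (- (P z ^+ 2 - (B z * P z - p * q * z * (1 - z))) / z).
      by rewrite /trc qE; field.
    by rewrite rel subrr oppr0 mul0r.
  have -> : (- (P z / z) - p) * (- (P z / z) + q) = P z * (P z - (q - y) * z) / z ^+ 2 / (1 - z).
    by rewrite -num; field; rewrite gt_eqF.
  have D0' : D z != 0 by rewrite gt_eqF.
  have P0' : P z != 0 by rewrite gt_eqF.
  have z1n : 1 - z != 0 by rewrite gt_eqF.
  move: (P z) (D z) P0' D0' => r d r0 d0'.
  by field; rewrite r0 d0' z0' z1n.
set X := (X in Num.sqrt X).
have X0 : 0 < X by rewrite /X !divr_gt0 // mulr_gt0.
rewrite sqrt_expR_ln //; congr expR.
rewrite /X /logampl !ln_div ?lnM ?posrE ?divr_gt0 ?mulr_gt0 //.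
by field.
Qed.

End Saddle.


(** The real form of the limit: of the three Stirling remainders one survives, with
    a minus sign, and cancels ln (2 pi) / 2. *)
Lemma krawtchouk_ratio_cvg (R : realType) (p q y z : R)
    (n : nat -> nat) (F : set_system nat) (FF : Filter F) :
  0 < p -> 0 < q -> p + q = 1 -> 0 <= y -> 0 < z -> z < p -> y < Yminus p q z ->
  (forall A, (\forall N \near \oo, A N) -> \forall N \near F, A N) ->
  (\forall N \near F, (n N)%:R = z * N%:R) ->
  expR (stirling_rem R N - stirling_rem R (n N) - stirling_rem R (N - n N)
        + ln (2 * pi) / 2)
  * (signed_quot p q y N (n N) / ansatz p q y N (n N)) @[N --> F] --> (1 : R).
Proof.
move=> p0 q0 pq1 y0 z0 zp yY near_oo nE.
have z1 : z < 1 by lra.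
have cw : signed_quot p q y N (n N) / ansatz p q y N (n N) @[N --> F] --> (1 : R).
  apply/cvgrPdist_le => e e0.
  have h := normalized_asymptotics R p q y z p0 q0 pq1 y0 z0
    (lt_pBy _ _ _ _ _ p0 q0 pq1 z0 zp yY) (disc_gt0 _ _ _ _ _ p0 q0 pq1 z0 zp yY) e e0.
  have {}h := near_oo _ h.
  apply: filterS2 h nE => N h nE; rewrite distrC.
  by apply: h; rewrite nE.
have cn : n N @[N --> F] --> \oo.
  apply/cvgnyPge => A.
  have h := near_oo _ (nbhs_infty_gtr (A%:R / z)).
  apply: filterS2 h nE => N; rewrite ltr_pdivrMr // => h nE.
  by rewrite -(ler_nat R) nE mulrC ltW.
have cm : (N - n N)%N @[N --> F] --> \oo.
  apply/cvgnyPge => A.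
  have h := near_oo _ (nbhs_infty_gtr (A%:R / (1 - z))).
  apply: filterS2 h nE => N; rewrite ltr_pdivrMr ?subr_gt0 // => h nE.
  have nN : (n N <= N)%N by rewrite -(ler_nat R) nE; have := ler0n R N; nra.
  by rewrite leq_subRL // -(ler_nat R) natrD nE; lra.
have cs := cvg_stirling_rem R.
have cs' : stirling_rem R N @[N --> F] --> ln (2 * pi) / 2.
  by move=> A /cs /near_oo.
set l := ln (2 * pi) / 2 in cs cs' *.
have cr : stirling_rem R N - stirling_rem R (n N) - stirling_rem R (N - n N) + l
    @[N --> F] --> l - l - l + l.
  apply: cvgD; last exact: cvg_cst.
  apply: cvgB; last exact: (cvg_comp _ _ cm cs).
  by apply: cvgB; last exact: (cvg_comp _ _ cn cs).
have l0 : l - l - l + l = 0 by ring.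
rewrite l0 in cr.
have := cvgM (cvg_comp _ _ cr (@continuous_expR R 0)) cw.
rewrite expR0 mulr1 => h; exact: h.
Qed.

Theorem mainTheorem3 (R : realType) (p q : R)
    (hp : 0 < p < 1) (hq : 0 < q < 1) (hpq : p + q = 1)
    (z y : R) (hz : 0 < z < p) (hy : 0 <= y < Yminus p q z) :
  (krawtchouk p q N (Num.truncn (z * N%:R)) (y * N%:R))%:C
    / ((1 / Num.sqrt (2 * pi * N%:R))%:C
       * expC (N%:R * psiminus p q y z) * (Lminus p q y z)%:C)
  @[N --> within [set N : nat | z * N%:R \is a Num.nat] \oo]
  --> (1 : R[i]^o).
Proof.
case/andP: hp => p0 p1; case/andP: hq => q0 q1; case/andP: hz => z0 zp.
case/andP: hy => y0 yY.
have z1 : z < 1 by exact: lt_trans p1.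
have pi0 := pi_gt0 R.
pose n N := Num.truncn (z * N%:R).
have FF : Filter (within [set N : nat | z * N%:R \is a Num.nat] \oo).
  exact: within_filter.
have near_oo A : (\forall N \near \oo, A N) ->
    \forall N \near within [set N : nat | z * N%:R \is a Num.nat] \oo, A N.
  exact: cvg_within.
have nE : \forall N \near within [set N : nat | z * N%:R \is a Num.nat] \oo,
    (n N)%:R = z * N%:R.
  by near=> N; apply: truncnK; near: N; exact: withinT.
have N0 : \forall N \near within [set N : nat | z * N%:R \is a Num.nat] \oo, (0 < N)%N.
  by apply: near_oo; exists 1%N.
have cg := krawtchouk_ratio_cvg R p q y z n _ FF p0 q0 hpq y0 z0 zp yY near_oo nE.
have := cvg_real_complex _ _ _ FF _ _ cg.
apply: cvg_trans; apply: near_eq_cvg.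
apply: filterS2 nE N0 => N nE N0; rewrite -/(n N).
have N0' : 0 < N%:R :> R by rewrite ltr0n.
rewrite (psiminusE R p q y z) // (LminusE R p q y z) //.
rewrite -(rmorph_nat (real_complex R)).
set Phi := (X in X +i* _).
have -> : (N%:R)%:C * (Phi +i* (z * pi)) = (N%:R * Phi) +i* ((n N)%:R * pi).
  by rewrite nE /=; simpc; congr (_ +i* _); ring.
rewrite /expC /= cosn_pi sinn_pi.
have -> : ((-1) ^+ n N +i* 0 : R[i]) = ((-1) ^+ n N)%:C by [].
rewrite -!rmorphM -fmorph_div; congr (_%:C).
have nN : (n N <= N)%N by rewrite -(ler_nat R) nE; nra.
have C0 : 'C(N, n N)%:R != 0 :> R by rewrite pnatr_eq0 -lt0n bin_gt0.
have s1 : (-1) ^+ n N * (-1) ^+ n N = 1 :> R by rewrite -expr2 sqrr_sign.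
have KE : krawtchouk p q N (n N) (y * N%:R) = (-1) ^+ n N * ('C(N, n N)%:R * signed_quot p q y N (n N)).
  rewrite /signed_quot.
  transitivity (((-1) ^+ n N * (-1) ^+ n N) * krawtchouk p q N (n N) (y * N%:R)); first by rewrite s1 mul1r.
  by field.
have s0 : (-1) ^+ n N != 0 :> R by rewrite signr_eq0.
rewrite KE sqrt_expR_ln ?mulr_gt0 //.
have e0 (t : R) : expR t != 0 by rewrite gt_eqF // expR_gt0.
have CE : 'C(N, n N)%:R * expR (ln (2 * pi * N%:R) / 2) * ansatz p q y N (n N) =
  expR (stirling_rem R N - stirling_rem R (n N) - stirling_rem R (N - n N)
     + ln (2 * pi) / 2) * expR (N%:R * Phi)
  * expR (logampl p q y z - (ln z + ln (1 - z)) / 2).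
  rewrite (binomial_stirling R z) ?z0 // /ansatz nE mulfK ?gt_eqF //.
  rewrite lnM ?posrE ?mulr_gt0 // -!expRD; congr expR; rewrite /Phi.
  move: (ln (2 * pi)) (phase p q y z) (logampl p q y z) => l G g.
  by field.
have A0 : ansatz p q y N (n N) != 0 by exact: e0.
apply: (mulIf A0); rewrite mulrA divfK //.
move: CE A0; move: (ansatz _ _ _ _ _) (signed_quot _ _ _ _ _) => A k CE A0.
move: CE (e0 (N%:R * Phi)) (e0 (logampl p q y z - (ln z + ln (1 - z)) / 2))
  (e0 (ln (2 * pi * N%:R) / 2)).
move: (expR (N%:R * Phi)) (expR (logampl p q y z - _)) (expR (ln _ / 2))
  (expR (_ + _)) => E L S r CE E0 L0 S0.
have -> : r = 'C(N, n N)%:R * S * A / (E * L).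
  by rewrite CE; field; rewrite E0 L0.
by move: ('C(N, n N)%:R) ((-1) ^+ n N) s0 => C s s0; field; rewrite S0 E0 L0 s0.
Unshelve. all: by end_near. Qed.
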